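(* A prosolvable group $G$ has the bounded intersection property if and only if it has the bounded chief factors property.
   Context: Let $G$ be a profinite group; maximal subgroups of $G$ are understood to be open. $G$ has the bounded intersection property if there exists a positive real number $\eta$ such that for every open subgroup $H$ of $G$ which is an intersection of maximal subgroups of $G$ there exists a family of maximal subgroups $M_1,\dots,M_t$ of $G$ with $H=M_1\cap\dots\cap M_t$ and $|G:M_1|\cdots|G:M_t|\le|G:H|^\eta$. Let $V$ be a (finite) irreducible $G$-module, $F=\operatorname{End}_G(V)$, and $\gamma$ a positive integer. $V$ is called a $\gamma$-module if for every $F$-subspace $W$ of $V$ there exists an $F$-subspace $W^*$ of $V$ such that (1) $\dim_F(W^* )\le\gamma$, and (2) $C_G(W)=C_G(W^* )\cap\bigl(\bigcap_{M\in\mathcal M_W}M\bigr)$, where $\mathcal M_W$ is the set of maximal subgroups of $G$ containing $C_G(W)$ (an empty intersection being $G$). A chief factor of $G$ means a chief factor $X/Y$ of $G$ with $X,Y$ open normal subgroups; it is complemented if $X/Y$ has a complement in $G/Y$. When $G$ is prosolvable, chief factors are irreducible $G$-modules under conjugation. $G$ has the bounded chief factors property if there exists a positive integer $\gamma$ such that every complemented chief factor of $G$ is a $\gamma$-module. *)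

(* Defs.v *)
From HB Require Import structures.
From mathcomp Require Import all_boot all_order all_algebra.
From mathcomp Require Import fingroup nilpotent finmap.
From mathcomp Require Import all_classical all_reals all_analysis.

Set Implicit Arguments.
Unset Strict Implicit.
Unset Printing Implicit Defensive.

Import Order.TTheory GRing.Theory Num.Theory.

Local Open Scope classical_set_scope.
Local Open Scope group_scope.

HB.mixin Record isTopologicalGroup G & monoid.Group G & Topological G := {
  mulg_continuous : continuous (fun x : G * G => x.1 * x.2);
  invg_continuous : continuous (fun x : G => x^-1)
}.

#[short(type="topologicalGroupType")]
HB.structure Definition TopologicalGroup :=
  {G of monoid.Group G & Topological G & isTopologicalGroup G}.

HB.mixin Record isProfinite G & TopologicalGroup G := {
  profinite_compact : compact [set: G];
  profinite_hausdorff : hausdorff_space G;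
  profinite_disconnected : totally_disconnected [set: G]
}.

#[short(type="profiniteGroupType")]
HB.structure Definition ProfiniteGroup :=
  {G of TopologicalGroup G & isProfinite G}.

Section Subgroups.
Context {G : topologicalGroupType}.
Implicit Types H K M N X Y : set G.

Definition subgroup H := H 1 /\ forall x y, H x -> H y -> H (x / y).

Definition normal_subgroup N := subgroup N /\ forall x g, N x -> N (x ^ g).

Definition maximal_subgroup M :=
  [/\ subgroup M, open M, M != [set: G] &
      forall K, subgroup K -> M `<=` K -> K = M \/ K = [set: G]].

(* The index |G : H|.  It is 0 when H has infinitely many cosets, which cannot
   happen for an open subgroup of a profinite group. *)
Definition subgroup_index H : nat :=
  #|` fset_set [set [set x * h | h in H] | x in [set: G]]|.

Definition chief_factor X Y :=
  [/\ normal_subgroup X, open X, normal_subgroup Y, open Y & Y `<` X] /\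
  forall N, normal_subgroup N -> Y `<=` N -> N `<=` X -> N = Y \/ N = X.

(* Subgroups of G/Y are K/Y with Y <= K; this says that K/Y is a complement of
   X/Y in G/Y. *)
Definition complemented X Y :=
  exists K, [/\ subgroup K, Y `<=` K, K `&` X = Y &
                [set k * x | k in K & x in X] = [set: G]].

End Subgroups.

(* Every finite continuous quotient of G is solvable. *)
Definition prosolvable (G : profiniteGroupType) :=
  forall (gT : finGroupType) (phi : {multiplicative G -> gT}),
    open [set g | phi g = 1] -> range phi = [set: gT] ->
    solvable (finset.setTfor gT).

Definition bounded_intersection_property (R : realType)
    (G : profiniteGroupType) :=
  exists2 eta : R, (0 < eta)%R &
  forall H : set G, subgroup H -> open H ->
    (exists2 MM : set (set G),
      MM `<=` maximal_subgroup & H = \bigcap_(M in MM) M) ->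
    exists (t : nat) (M : 'I_t -> set G),
      [/\ forall i, maximal_subgroup (M i),
          H = \bigcap_i M i &
          ((\prod_(i < t) subgroup_index (M i))%N%:R <= (subgroup_index H)%:R `^ eta :> R)%R].

(* Finite (discrete) modules. The axiom gact_continuous is the continuity of
   G * V -> V for the discrete topology on V. *)
Record gmodule (G : topologicalGroupType) (V : finZmodType) := GModule {
  gact :> G -> V -> V;
  gact1 : forall v, gact 1 v = v;
  gactM : forall g h v, gact (g * h) v = gact g (gact h v);
  gactD : forall g u v, gact g (u + v)%R = (gact g u + gact g v)%R;
  gact_continuous : forall u v, open [set g | gact g u = v]
}.

Section Modules.
Context {G : topologicalGroupType} {V : finZmodType} (A : gmodule G V).
Implicit Types W : set V.
Local Open Scope ring_scope.

Definition additive_subgroup W := W 0 /\ forall u v, W u -> W v -> W (u - v).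

Definition irreducible_module :=
  (exists v : V, v != 0) /\
  forall W, additive_subgroup W -> (forall g v, W v -> W (A g v)) ->
    W = [set 0] \/ W = [set: V].

(* f \in F := End_G(V) *)
Definition End_G (f : {additive V -> V}) := forall g v, f (A g v) = A g (f v).

Definition F_subspace W :=
  additive_subgroup W /\ forall f, End_G f -> forall v, W v -> W (f v).

Definition F_basis W d (b : 'I_d -> V) :=
  [/\ forall i, W (b i),
      forall w, W w -> exists2 c : 'I_d -> {additive V -> V},
        (forall i, End_G (c i)) & w = \sum_i c i (b i) &
      forall c : 'I_d -> {additive V -> V}, (forall i, End_G (c i)) ->
        \sum_i c i (b i) = 0 -> forall i v, c i v = 0].

Definition F_dim W d := exists b : 'I_d -> V, F_basis W b.

Definition centraliser W : set G := [set g | forall w, W w -> A g w = w].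

Definition gamma_module (gamma : nat) :=
  irreducible_module /\
  forall W, F_subspace W ->
    exists W' : set V,
      [/\ F_subspace W',
          exists2 d, F_dim W' d & (d <= gamma)%N &
          centraliser W = centraliser W' `&`
            \bigcap_(M in [set M | maximal_subgroup M /\ centraliser W `<=` M])
              M].

(* V is isomorphic, as a G-module, to X/Y with G acting by conjugation:
   p restricted to X is the projection X -> X/Y, its values outside X are
   irrelevant. *)
Definition module_of_factor (X Y : set G) :=
  exists p : G -> V,
    [/\ forall x y, X x -> X y -> p (x * y)%g = p x + p y,
        forall x, X x -> (p x = 0 <-> Y x),
        p @` X = [set: V] &
        forall g x, X x -> p (g * x * g^-1)%g = A g (p x)].

End Modules.

(* Modules being carried by additive types, "X/Y is a gamma-module" is stated
   for a copy V of X/Y; gamma_module is invariant under isomorphism. *)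
Definition bounded_chief_factors_property (G : profiniteGroupType) :=
  exists2 gamma : nat, (0 < gamma)%N &
  forall X Y : set G, chief_factor X Y -> complemented X Y ->
    exists (V : finZmodType) (A : gmodule G V),
      module_of_factor A X Y /\ gamma_module A gamma.

(* Main.v *)
(* Let N be a complemented minimal normal subgroup of a finite solvable group G.
   Two complements M1, M2 of N which meet C_G(N) in the same subgroup are
   conjugate under N; otherwise N (M1 :&: M2) is a maximal subgroup of G.  Hence
   if H is an intersection of maximal subgroups, one of which, M1, complements
   N, then H is the intersection of M1, of the maximal subgroups above H N, and
   of the conjugates of M1 by C_N(H); by the gamma-module condition, gamma of
   the latter suffice.  Induction on |G| yields eta = gamma + 1.
   Conversely, if K complements the chief factor V and W <= V, then C_K(W) is
   the intersection of the K ^ w.  Its index is at most |V|^7, so the bounded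
   intersection property writes it with at most 7 eta complements of V, all of
   them conjugate to K, and the conjugating elements span W^*.  The bound on
   the index rests on |G / C_G(V)| <= |V|^6, a weak form of a theorem of Palfy
   and Wolf.  It is proved by induction on |V|: if V is imprimitive then G is
   bounded by the block stabiliser and a solvable permutation group; otherwise
   a maximal abelian normal subgroup A of G is cyclic and faithful on every
   A-submodule, and the size of G above A is controlled by the fact that a
   transversal of A in a suitable B is linearly independent over the field F[A],
   whence |B : A| <= k^2 with (|A| + 1)^k <= |V|. *)

From HB Require Import structures.
From mathcomp Require Import all_boot all_order all_fingroup all_algebra.
From mathcomp Require Import all_solvable all_field all_character zify.

Set Implicit Arguments.
Unset Strict Implicit.
Unset Printing Implicit Defensive.

Import GRing.Theory.

Local Open Scope group_scope.

(** * Orders of solvable irreducible linear groups *)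

Section CoreIndex.
Variable gT : finGroupType.
Implicit Types G H K L M N X Y : {group gT}.

Lemma leq_index_capr G K H : K \subset G -> #|K : K :&: H| <= #|G : H|.
Proof.
move=> sKG; rewrite indexgI.
apply: subset_leq_card; apply/subsetP=> _ /rcosetsP[x Kx ->].
by apply/rcosetsP; exists x; rewrite ?(subsetP sKG).
Qed.

Lemma leq_index_setI G H K :
  H \subset G -> K \subset G -> #|G : H :&: K| <= #|G : H| * #|G : K|.
Proof.
move=> sHG sKG; rewrite -(Lagrange_index sHG (subsetIl H K)) leq_mul2l.
by rewrite leq_index_capr ?orbT.
Qed.

(** [gcore X G] is the intersection of [gcore N G] with the conjugates of [X]. There are at most
    [#|G : N|] conjugates, because [N] normalises [X], and each of them multiplies the index by at
    most [#|N : X|]. *)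
Lemma gcore_index_leq G N X :
    N \subset G -> X <| N ->
  #|G : gcore X G| <= #|G : gcore N G| * #|N : X| ^ #|G : N|.
Proof.
move=> sNG /andP[sXN nXN].
have sKG : gcore N G \subset G := subset_trans (gcore_sub _ _) sNG.
have sXG := subset_trans sXN sNG.
have sXK : gcore X G \subset gcore N G.
  by rewrite sub_gcore ?gcore_norm // (subset_trans (gcore_sub _ _)).
suff: #|gcore N G : gcore X G| <= #|N : X| ^ #|G : N|.
  move=> le_X; rewrite -(Lagrange_index sKG sXK) leq_mul2l.
  by rewrite le_X orbT.
pose O := orbit 'JG%act G X.
have le_conj: #|O| <= #|G : N|.
  rewrite card_orbit astab1JG; apply: dvdn_leq => //.
  by apply: indexgS; rewrite subsetI sNG.
have idx_gt0: 0 < #|N : X| by [].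
apply: leq_trans (leq_pexp2l idx_gt0 le_conj).
have -> : gcore X G = gcore N G :&: \bigcap_(Y in O) Y.
  have -> : \bigcap_(Y in O) Y = gcore X G.
    apply/setP=> y; apply/bigcapP/bigcapP => [Xy x Gx | Xy _ /orbitP[x Gx <-]].
      exact: Xy (X :^ x)%G (mem_orbit _ _ Gx).
    exact: Xy.
  exact/esym/setIidPr.
rewrite cardE -big_enum /=.
have: all [in O] (enum O) by apply/allP=> Y; rewrite mem_enum.
elim: (enum _) => [|Y s IHs] /=; first by rewrite big_nil setIT indexgg.
case/andP=> /orbitP[x Gx <-] {Y} /IHs{}IHs; rewrite big_cons expnS.
have -> A B : gcore N G :&: (A :&: B) =
   (gcore N G :&: A) :&: (gcore N G :&: B) by rewrite setIACA setIid.
(* The iterated intersection is only a set; the index lemmas need a group equal to it. *)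
have [I defI] : exists I : {group gT}, \bigcap_(Y <- s) Y = I :> {set gT}.
  elim/big_rec: _ => [|Y _ _ [I ->]]; first by exists [set: gT]%G.
  by exists (Y :&: I)%G.
rewrite {}defI in IHs *.
apply: leq_trans (leq_index_setI (subsetIl _ (X :^ x)%G) (subsetIl _ I)) _.
apply: leq_mul IHs.
(* The core of [N] lies in [N :^ x], where [X :^ x] has index [#|N : X|]. *)
have sKN : gcore N G \subset N :^ x by exact: bigcap_inf.
apply: leq_trans (leq_index_capr _ sKN) _.
by rewrite indexJg.
Qed.

End CoreIndex.

(* The factor 2 ^ 6 makes the bound compatible with systems of k blocks of size
   w: (w ^ 6 / 2 ^ 6) ^ k * 2 ^ (6 * (k - 1)) = (w ^ k) ^ 6 / 2 ^ 6. *)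
Definition irr_bound m := forall (F : finFieldType) (gT : finGroupType)
    (G : {group gT}) n (rG : mx_representation F G n),
  solvable G -> mx_irreducible rG -> #|F| ^ n < m ->
  2 ^ 6 * #|G : rker rG| <= (#|F| ^ n) ^ 6.

Lemma mul_maximal_normal (gT : finGroupType) (G L N : {group gT}) :
  maximal L G -> N <| G -> ~~ (N \subset L) -> L * N = G.
Proof.
case/maxgroupP=> sLG maxL /andP[sNG nNG] notNL; have sLG' := proper_sub sLG.
have nNL := subset_trans sLG' nNG.
apply/eqP; rewrite eqEproper mul_subG // -norm_joinEl //.
apply: contra notNL => /maxL/(_ (joing_subl _ _)) <-; exact: joing_subr.
Qed.

(** Turns the bound [k ^ 7] for a primitive solvable permutation group of degree [k] into the
    exponential form that survives the induction in [core_bound]. *)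
Lemma expn7_leq k : 1 < k -> k ^ 7 <= 2 ^ (6 * k).
Proof.
elim: k => // -[|[|k]] // IHk _; rewrite mulnS expnD.
have {IHk} := leq_mul (leqnn (2 ^ 6)) (IHk isT); apply: leq_trans.
(* After scaling by [2 ^ 7] the step rests on [2 * k.+3 <= 3 * k.+2] and [3 ^ 7 <= 2 ^ 13]. *)
rewrite -(leq_pmul2l (isT : 0 < 2 ^ 7)) -expnMn.
apply: leq_trans (_ : (3 * k.+2) ^ 7 <= _); first by rewrite leq_exp2r //; lia.
by rewrite expnMn mulnA leq_mul2r; apply/orP; right.
Qed.

(** * Solvable permutation groups, given the bound for small modules *)

Section Consequences.
Variable m : nat.
Hypothesis bound : irr_bound m.

(** [N] is elementary abelian, hence an irreducible module over a prime field on which [G] acts with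
    kernel ['C_G(N)]. *)
Lemma minnormal_bound (gT : finGroupType) (G N : {group gT}) :
    solvable G -> minnormal N G -> N \subset G -> #|N| < m ->
  2 ^ 6 * #|G : 'C_G(N)| <= #|N| ^ 6.
Proof.
move=> solG minN sNG ltNm.
have [_ ntN /is_abelemP[p p_pr abelN]] := minnormal_solvable minN sNG solG.
have /mingroupp/andP[_ nNG] := minN.
have irrN : mx_irreducible (abelem_repr abelN ntN nNG) by apply/abelem_mx_irrP.
have := bound solG irrN.
rewrite card_Fp // rker_abelem /= -(card_abelem_rV abelN ntN) card_mx mul1n
  card_Fp //.
apply.
by rewrite -(card_abelem_rV abelN ntN) card_mx mul1n card_Fp in ltNm.
Qed.

(** [G] acts faithfully and primitively on the cosets of [L]. For a minimal normal subgroup [N], the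
    group ['C_G(N) :&: L] is normalised by [L] and centralised by [N], so it is normal in
    [G = L * N] and therefore trivial. Hence [N] and ['C_G(N)] have order at most the degree, and
    [minnormal_bound] handles [G] modulo ['C_G(N)]. *)
Lemma corefree_maximal_bound (gT : finGroupType) (G L : {group gT}) :
    solvable G -> maximal L G -> gcore L G = 1 -> #|G : L| < m ->
  2 ^ 6 * #|G| <= 2 ^ (6 * #|G : L|).
Proof.
move=> solG maxL coreL1 ltLm.
have sLG : L \subset G := proper_sub (maxgroupp maxL).
have coreL (X : {group gT}) : X <| G -> X \subset L -> X :=: 1.
  by move=> /andP[sXG nXG] sXL; apply/trivgP; rewrite -coreL1 gcore_max.
have ntG : G :!=: 1.
  rewrite -subG1; apply: contraL (maxgroupp maxL) => sG1.
  by rewrite properE sLG (subset_trans sG1) ?sub1G.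
have [N minN sNG] := minnormal_exists ntG (normG _).
have [_ ntN /is_abelemP[p _ /abelem_abelian cNN]] :=
  minnormal_solvable minN sNG solG.
have nsNG : N <| G by rewrite /normal sNG; have /mingroupp/andP[] := minN.
have notNL : ~~ (N \subset L) by apply: contra ntN => /coreL->.
have prodLN := mul_maximal_normal maxL nsNG notNL.
have nCG : 'C_G(N) <| G by rewrite /normal subsetIl normsI ?normG ?norms_cent
  ?normal_norm.
have tiCL : 'C_G(N) :&: L = 1.
  apply: (coreL ('C_G(N) :&: L)%G); last exact: subsetIr.
  rewrite /normal subIset ?subsetIl //= -{1}prodLN mul_subG //.
    by rewrite normsI ?normG // (subset_trans sLG) ?normal_norm.
  by rewrite cents_norm // centsC subIset // subsetIr.
have leC : #|'C_G(N)| <= #|G : L|.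
  rewrite -(leq_pmul2r (cardG_gt0 L)) -(TI_cardMg tiCL) mulnC Lagrange //.
  by rewrite subset_leq_card // mul_subG // subsetIl.
have leN : #|N| <= #|G : L|.
  by apply: leq_trans leC; rewrite subset_leq_card // subsetI sNG.
have := minnormal_bound solG minN sNG (leq_ltn_trans leN ltLm).
have sCG : 'C_G(N) \subset G := subsetIl _ _.
rewrite -(Lagrange sCG) => le1.
have k_gt1 : 1 < #|G : L| by rewrite indexg_gt1; case/andP: (maxgroupp maxL).
have le2 : #|N| ^ 6 <= #|G : L| ^ 6 by rewrite leq_exp2r.
rewrite mulnCA; apply: leq_trans (leq_mul leC (leq_trans le1 le2)) _.
rewrite -expnS.
exact: expn7_leq.
Qed.

Lemma maximal_core_bound (gT : finGroupType) (G L : {group gT}) :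
    solvable G -> maximal L G -> #|G : L| < m ->
  2 ^ 6 * #|G : gcore L G| <= 2 ^ (6 * #|G : L|).
Proof.
move=> solG maxL ltLm; pose K := [group of gcore L G].
have sLG : L \subset G := proper_sub (maxgroupp maxL).
have sKL : K \subset L := gcore_sub L G.
have nsKG : K <| G := gcore_normal sLG.
have nsKL : K <| L := normalS sKL sLG nsKG.
have -> : #|G : L| = #|G / K : L / K| by rewrite index_quotient_eq ?normal_norm
  // subIset ?sKL ?orbT.
rewrite -(card_quotient (normal_norm nsKG)).
apply: corefree_maximal_bound; rewrite ?quotient_sol ?quotient_maximal //.
  apply/trivgP; set X := gcore_group _ _.
  have nsXG : X <| G / K by rewrite gcore_normal ?quotientS.
  have [Y defX sKY nsYG] := inv_quotientN nsKG nsXG.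
  have sYG := normal_sub nsYG.
  have sYL : Y \subset L.
    rewrite -(quotientSGK (subset_trans sYG (normal_norm nsKG)) sKL) -defX.
    exact: gcore_sub.
  rewrite defX quotient_sub1 ?(subset_trans sYG (normal_norm nsKG)) //.
  exact: gcore_max sYL (normal_norm nsYG).
by rewrite index_quotient_eq ?normal_norm // subIset ?sKL ?orbT.
Qed.

(** An exponential bound for a solvable transitive permutation group of degree [#|G : M|]. For a
    maximal [L] above [M], the core of [M] contains the core in [G] of [gcore M L], so
    [gcore_index_leq] combines the bound for [L] in [G] with the inductive one for [M] in [L]. *)
Lemma core_bound (gT : finGroupType) (G M : {group gT}) :
    solvable G -> M \subset G -> #|G : M| < m ->
  2 ^ 6 * #|G : gcore M G| <= 2 ^ (6 * #|G : M|).
Proof.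
move: {2}_.+1 (ltnSn #|G : M|) => k; elim: k => // k IHk in G M *.
rewrite ltnS => leMk solG sMG ltMm.
have [defM | [L maxL sML]] := maximal_exists sMG.
  by rewrite defM indexgg (eqP (_ : gcore G G == G)) ?indexgg ?eqEsubset
    ?gcore_sub ?gcore_max ?normG.
have sLG : L \subset G := proper_sub (maxgroupp maxL).
have k_gt1 : 1 < #|G : L| by rewrite indexg_gt1; case/andP: (maxgroupp maxL).
have oM := Lagrange_index sLG sML.
have lt_LM : #|L : M| < #|G : M| by rewrite -oM ltn_Pmull.
have leL : #|G : L| < m by apply: leq_ltn_trans ltMm; rewrite -oM leq_pmulr.
have bL := maximal_core_bound solG maxL leL.
have bM := IHk L M (leq_trans lt_LM leMk) (solvableS sLG solG) sML (ltn_trans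
  lt_LM ltMm).
have nsXL : gcore M L <| L := gcore_normal sML.
have := gcore_index_leq sLG nsXL.
have le_core : #|G : gcore M G| <= #|G : gcore (gcore M L) G|.
  apply: dvdn_leq => //; apply: indexgS; rewrite gcore_max ?gcore_norm //.
  exact: subset_trans (gcore_sub _ _) (gcore_sub _ _).
move/(leq_trans le_core); rewrite -oM; set a := #|G : L| in k_gt1 bL *.
move=> le_idx; have l_gt0 : 0 < #|L : M| by [].
(* With [a = #|G : L|] and [l = #|L : M|], cancelling one factor [2 ^ 6] in [bM] leaves the exponent
   [6 * (l - 1)]; then [6 a + 6 (l - 1) a = 6 a l]. *)
rewrite !expnM in bL bM *; rewrite -(prednK l_gt0) in bM *.
rewrite [((2 ^ 6) ^ _.+1)%N]expnS leq_pmul2l // in bM.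
apply: leq_trans (leq_mul (leqnn _) le_idx) _; rewrite mulnA.
apply: leq_trans (leq_mul bL (_ : _ <= ((2 ^ 6) ^ #|L : M|.-1) ^ a)) _.
  by rewrite leq_exp2r // ltnW.
by rewrite -!expnM -expnD leq_exp2l //; lia.
Qed.

End Consequences.

(** * Modules with several homogeneous components *)

Section Imprimitive.
Variables (F : finFieldType) (gT : finGroupType) (G A : {group gT}) (n : nat).
Variable rG : mx_representation F G n.
Hypothesis bound : irr_bound (#|F| ^ n).
Hypotheses (solG : solvable G) (irrG : mx_irreducible rG) (ffulG :
  mx_faithful rG).

(** [G] permutes the homogeneous components transitively. The stabiliser [N] of a component [W] is
    irreducible on [W], with kernel [X]. The inductive bound applies to [N] modulo [X], [core_bound]
    applies to the permutation action, and [gcore_index_leq] combines them because [X] has trivial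
    core. *)
Lemma imprimitive_bound (nsAG : A <| G)
    (sA : socleType (subg_repr rG (normal_sub nsAG))) :
  1 < #|{: sA}| -> 2 ^ 6 * #|G| <= (#|F| ^ n) ^ 6.
Proof.
move=> k_gt1; have /card_gt0P[W _] : 0 < #|{: sA}| by apply: ltnW.
have F_gt1 : 1 < #|F| := finNzRing_gt1 F.
have oW := Clifford_rank_components irrG W.
have simW := Clifford_rstabs_simple irrG W.
have rW_gt0 : 0 < \rank W by rewrite lt0n mxrank_eq0; have [] := simW.
have sNG := rstabs_sub rG W; set N := [group of rstabs rG W] in simW sNG.
have oN : #|G : N| = #|{: sA}|.
  transitivity #|G : 'C_G[W | Clifford_action sA]|.
    by rewrite Clifford_astab1 (setIidPr sNG).
  rewrite -card_orbit_in ?subxx // -cardsT; congr #|pred_of_set _|.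
  by rewrite (atransPin (subxx G) (Clifford_atrans irrG sA)) ?inE.
have n_gt0 : 0 < n by case/mx_irrP: irrG.
have [lekn ltrW] : #|{: sA}| <= n /\ \rank W < n.
  have aux (a b c : nat) : 0 < b -> 1 < a -> (a * b)%N = c -> a <= c /\ b < c.
    by move=> b_gt0 a_gt1 <-; rewrite leq_pmulr // ltn_Pmull.
  exact: aux oW.
have ltkn : #|{: sA}| < #|F| ^ n.
  exact: leq_ltn_trans lekn (ltn_expl n F_gt1).
have ltrn : #|F| ^ \rank W < #|F| ^ n.
  by rewrite ltn_exp2l.
pose modW := mxsimple_module simW.
have irrW : mx_irreducible (submod_repr modW) by apply/submod_mx_irr.
pose X := [group of rstab (subg_repr rG (rstabs_sub rG W)) W].
have bW := bound (solvableS sNG solG) irrW ltrn.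
rewrite rker_submod -[rstab _ _]/(gval X) in bW.
have nsXN : X <| N by rewrite /normal rstab_sub rstab_norm.
have sXG : X \subset G := subset_trans (normal_sub nsXN) sNG.
have coreX1 : gcore X G = 1.
  (* The core fixes [W], so its fixed space is a nonzero submodule, hence everything; faithfulness
     concludes. *)
  pose K := [group of gcore X G].
  suffices sKr : K \subset rker rG by apply/trivgP; apply: subset_trans ffulG.
  have sKX : K \subset X := gcore_sub _ _.
  have nsKG : K <| G by exact: gcore_normal sXG.
  have sWK : (W <= rfix_mx rG K)%MS.
    rewrite -rfix_mx_rstabC ?(normal_sub nsKG) //; apply: subset_trans sKX _.
    by rewrite /= rstab_subg subsetIr.
  rewrite rfix_mx_rstabC ?(normal_sub nsKG) // sub1mx.
  have [_ irr1] := (mx_irrP rG).1 irrG; apply: irr1;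
    first exact: normal_rfix_mx_module.
  by rewrite -submx0; apply: contra (nz_socle W) => /(submx_trans sWK);
    rewrite submx0.
have := gcore_index_leq sNG nsXN.
rewrite /= coreX1 indexg1 oN => le_idx.
have sNG' : N \subset G := sNG.
have := core_bound bound solG sNG'; rewrite oN => /(_ ltkn) bN.
apply: leq_trans (leq_mul (leqnn _) le_idx) _; rewrite mulnA.
apply: leq_trans (leq_mul bN (leqnn _)) _.
rewrite expnM -expnMn.
have -> : ((#|F| ^ n) ^ 6 = ((#|F| ^ \rank W) ^ 6) ^ #|{: sA}|)%N.
  transitivity (#|F| ^ (#|{: sA}| * \rank W * 6))%N; first by rewrite oW expnM.
  by rewrite -!expnM; congr expn; lia.
by rewrite leq_exp2r // ltnW.
Qed.

End Imprimitive.

(** * Linear independence of eigenmatrices *)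

Section Independence.
Local Open Scope ring_scope.
Variables (K : fieldType) (k : nat) (I : finType) (X : I -> 'M[K]_k).
Hypothesis nzX : forall i, X i != 0.
Hypothesis sepX : forall i j, i != j -> exists P Q (mu : I -> K),
  (forall l, P *m X l *m Q = mu l *: X l) /\ mu i != mu j.

(* Minimal support: subtracting a multiple of the relation from its image under
   P *m _ *m Q kills the i-th term but not the j-th one. *)
Lemma separated_eigenmatrices_free (c : I -> K) :
  \sum_i c i *: X i = 0 -> forall i, c i = 0.
Proof.
move: {2}_.+1 (ltnSn #|[pred i | c i != 0]|) => m.
elim: m => // m IHm in c *; rewrite ltnS => lecm c0 i.
apply/eqP; apply: contraT => nzi.
have [j /andP[nzj neij] | c1] := pickP [pred j | (c j != 0) && (i != j)].
  have [P [Q [mu [mu_X ne_mu]]]] := sepX neij.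
  have c'0 : \sum_l (c l * (mu l - mu i)) *: X l = 0.
    transitivity (P *m (\sum_l c l *: X l) *m Q - mu i *: (\sum_l c l *: X l)).
      rewrite mulmx_sumr mulmx_suml scaler_sumr -sumrB; apply: eq_bigr => l _.
      by rewrite -scalemxAr -scalemxAl mu_X !scalerA -scalerBl mulrBr [mu i *
        _]mulrC.
    by rewrite c0 mulmx0 mul0mx scaler0 subr0.
  suffices lt_m : (#|[pred l | (c l * (mu l - mu i) != 0)%R]| < m)%N.
    have /eqP := IHm _ lt_m c'0 j.
    by rewrite mulf_eq0 (negPf nzj) subr_eq0 eq_sym (negPf ne_mu).
  apply: leq_trans lecm; apply: proper_card; apply/properP; split.
    by apply/subsetP=> l; rewrite !inE mulf_eq0 => /norP[].
  by exists i; rewrite !inE // subrr mulr0 eqxx.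
move/eqP: c0; rewrite (bigD1 i) //= big1 ?addr0; last first.
  move=> l neli; have := c1 l; rewrite inE [i == l]eq_sym neli andbT.
  by move/negbFE/eqP->; rewrite scale0r.
by rewrite scaler_eq0 (negPf nzi) (negPf (nzX i)).
Qed.

Lemma card_separated_eigenmatrices : (#|I| <= k ^ 2)%N.
Proof.
pose M : 'M_(#|I|, k * k) := \matrix_i mxvec (X (enum_val i)).
suffices /eqP <- : row_free M by exact: rank_leq_col.
apply: inj_row_free => v vM0.
have c0 : \sum_i v 0 (enum_rank i) *: X i = 0.
  apply: (can_inj mxvecK); rewrite linear0 -vM0 linear_sum mulmx_sum_row /=.
  rewrite (reindex (fun i : 'I_#|I| => enum_val i)) /=;
    last exact/onW_bij/enum_val_bij.
  by apply: eq_bigr => i _; rewrite enum_valK linearZ rowK.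
apply/rowP=> i; rewrite mxE -[i]enum_valK.
exact: (separated_eigenmatrices_free c0).
Qed.

End Independence.

Import MatrixGenField.

(** * Irreducible modules for a group with a cyclic central subgroup *)

Section CentralCyclic.
Variables (F : finFieldType) (gT : finGroupType) (A E B : {group gT}) (n : nat).
Variable rB : mx_representation F B n.

(* Over the field F[A], a transversal of A in B consists of eigenmatrices for
   conjugation by E, with pairwise distinct eigenvalue functions E -> A. *)
Lemma central_cyclic_bound :
    mx_irreducible rB -> cyclic A -> A \subset 'Z(B) -> E \subset B ->
    A :&: rker rB = 1 -> [~: B, E] \subset A -> 'C_B(E) \subset A ->
  exists k, #|B : A| <= k ^ 2 /\ #|A|.+1 ^ k <= #|F| ^ n.
Proof.
move=> irrB /cyclicP[a defA] sAZ sEB faithA sBEA sCA.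
case: n rB irrB faithA => [|n'] r irr faithA; first by case/mx_irrP: irr.
have sAB : A \subset B := subset_trans sAZ (center_sub B).
have Aa : a \in A by rewrite defA cycle_id.
have Ba := subsetP sAB a Aa.
have centA x y : x \in A -> y \in B -> commute x y.
  by move=> Ax By; have /setIP[_ /centP] := subsetP sAZ x Ax; apply.
have cBa : centgmx r (r a).
  by apply/centgmxP=> x Bx; rewrite -!repr_mxM // centA.
(* By Schur's lemma [r a] generates a field [K], which is F[A]. The witness [k] is the dimension of
   the module over [K]. *)
pose K := MatrixGenField.gen_of irr cBa; pose rK := gen_repr irr cBa.
exists (gen_dim (r a)).
have injA : {in A &, injective r}.
  move=> x y Ax Ay eqr.
  have Bx := subsetP sAB x Ax; have By := subsetP sAB y Ay.
  apply/eqP; rewrite eq_mulgV1 -in_set1 -[set1 _]/(1 : {set gT}) -faithA inE.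
  rewrite groupM ?groupV //=.
  by apply/rkerP; rewrite groupM ?groupV // repr_mxM ?groupV // eqr -repr_mxM
    ?groupV // mulgV repr_mx1.
have scalA x : x \in A -> exists2 z : K, mxval z = r x & rK x = (z%:M)%R.
  rewrite {1}defA => /cycleP[i ->]; exists (groot irr cBa ^+ i)%R.
    by rewrite mxval_grootXn -repr_mxX.
  apply: (can_inj (@val_genK _ _ _ _ _ _ irr cBa _)).
  rewrite -[rK _]mul1mx val_genJ ?groupX // repr_mxX //.
  rewrite -(mxval_grootXn irr cBa).
  by rewrite -val_genZ scalemx1.
(* The module has order [#|K| ^ k], and [A] embeds into the nonzero elements of [K]. *)
split; last first.
  have -> : (#|F| ^ n'.+1 = (#|F| ^ degree_mxminpoly (r a)) ^ gen_dim (r a))%N.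
    by rewrite -expnM mulnC (gen_dim_factor irr cBa).
  rewrite leq_exp2r ?(gen_dim_gt0 irr cBa) // -(card_gen irr cBa).
  have [z r_z rK_z] := fin_all_exists2 (fun x : subg_of A =>
    scalA (sgval x) (subgP x)).
  have inj_z : injective z.
    by move=> x y /(congr1 mxval); rewrite !r_z => /injA/val_inj; apply;
      exact: subgP.
  suffices leA : #|A| <= #|predC1 (0%R : K)|.
    apply: leq_ltn_trans leA _; rewrite cardC1 prednK //.
    by apply/card_gt0P; exists 0%R.
  have <- : #|{: subg_of A}| = #|A| by rewrite card_sub.
  rewrite -(card_codom inj_z).
  apply/subset_leq_card/subsetP=> _ /codomP[x ->]; rewrite !inE.
  apply: contra_eq_neq (r_z x) => ->; rewrite mxval0 eq_sym.
  by have := repr_mx_unit r (subsetP sAB _ (subgP x));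
    apply: contraTneq => ->; rewrite -row_free_unit /row_free mxrank0.
have dK_gt0 := gen_dim_gt0 irr cBa.
pose I := {C : {set gT} | C \in rcosets A B}.
have -> : #|B : A| = #|{: I}| by rewrite card_sig; apply: eq_card.
have BI (C : I) : repr (val C) \in B.
  case: C => _ /= /rcosetsP[x Bx ->]; case: repr_rcosetP => y Ay.
  by rewrite groupM ?(subsetP sAB y).
apply: (@card_separated_eigenmatrices _ _ _ (fun C : I => rK (repr (val C)))).
  move=> C; have := repr_mx_unit rK (BI C); apply: contraTneq => ->.
  by rewrite -row_free_unit /row_free mxrank0 eq_sym -lt0n.
move=> C D neCD.
(* If every [e] commuted with the quotient of the two representatives, this quotient would lie in
   ['C_B(E)], hence in [A], and the cosets would coincide. *)
have [e Ee not_ce] : exists2 e, e \in E & repr (val C) * (repr (val D))^-1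
  \notin 'C[e].
  apply/exists_inP; apply: contraT; rewrite negb_exists_in => /forall_inP cE.
  case/eqP: neCD; apply: val_inj.
  have defC (C' : I) : val C' = A :* repr (val C').
    by case: C' => _ /= /rcosetsP[x Bx ->]; rewrite rcoset_repr.
  rewrite (defC C) (defC D); apply/rcoset_eqP.
  rewrite mem_rcoset (subsetP sCA) // inE groupM ?groupV ?BI //=.
  by apply/centP=> e Ee; apply/cent1P; have := cE e Ee; rewrite negbK.
set t := repr (val C) in not_ce *; set u := repr (val D) in not_ce *.
have Be := subsetP sEB e Ee.
have [z r_z rK_z] := fin_all_exists2 (fun C : I =>
  scalA _ (subsetP sBEA _ (mem_commg (BI C) Ee))).
(* Conjugation by [e] multiplies [rK x] by [rK [~ x, e]], a scalar of [K] because the commutator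
   lies in [A]. *)
exists (rK e^-1), (rK e), z; split=> [C' | ].
  rewrite -!repr_mxM ?groupM ?groupV // -mulgA -/(_ ^ e) conjg_mulR repr_mxM //.
    by rewrite rK_z mul_mx_scalar.
  by rewrite (subsetP sAB) // (subsetP sBEA) // mem_commg.
apply: contra not_ce => /eqP eq_z; apply/cent1P/commgP/conjg_fixP.
have eq_comm : [~ t, e] = [~ u, e].
  by apply: injA; rewrite ?(subsetP sBEA) ?mem_commg ?BI // -[LHS]r_z eq_z r_z.
by rewrite conjMg conjVg !(conjg_mulR _ e) eq_comm invMg mulgA mulgK.
Qed.

End CentralCyclic.

Lemma ex_mxsimple (F : finFieldType) (gT : finGroupType) (G : {group gT}) n
    (rG : mx_representation F G n) : 0 < n -> exists V, mxsimple rG V.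
Proof.
move=> n_gt0; pose P (V : 'M[F]_n) := mxmodule rG V && (V != 0%R).
have P1 : P (1%:M)%R by rewrite /P mxmodule1 -mxrank_eq0 mxrank1 -lt0n.
have [V /andP[modV nzV] minV] := arg_minnP (fun V : 'M[F]_n => \rank V) P1.
exists V; split=> // U modU sUV nzU.
by rewrite -(geq_leqif (mxrank_leqif_sup sUV)) minV // /P modU.
Qed.

(** * Abelian normal subgroups acting homogeneously *)

Section Primitive.
Variables (F : finFieldType) (gT : finGroupType) (G : {group gT}) (n : nat).
Variable rG : mx_representation F G n.
Hypotheses (irrG : mx_irreducible rG) (ffulG : mx_faithful rG).
Hypothesis primG : forall (A : {group gT}) (nsAG : A <| G)
  (sA : socleType (subg_repr rG (normal_sub nsAG))),
    abelian A -> #|{: sA}| <= 1.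

(** An element [x] of the stabiliser fixes a simple [A]-submodule [S] of [U] pointwise. All simple
    [A]-submodules are isomorphic to [S], and the whole module is a sum of translates of [S], so [x]
    acts trivially and is [1] by faithfulness. *)
Lemma primitive_rstab_abelian (A : {group gT}) (nsAG : A <| G) (U : 'M_n) :
    abelian A -> mxmodule (subg_repr rG (normal_sub nsAG)) U -> U != 0%R ->
  rstab (subg_repr rG (normal_sub nsAG)) U = 1.
Proof.
set sAG := normal_sub nsAG; set rA := subg_repr rG sAG => cAA modU nzU.
apply/eqP; apply: (@socle_exists F gT A n rA) => sA; apply/eqP/trivgP.
apply: subset_trans ffulG; apply/subsetP=> x Ux.
have [Ax _] := setIdP Ux; have Gx := subsetP sAG x Ax.
apply: (mxsimple_exists modU nzU) => -[S simS sSU].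
have [X /subsetP sXG [defX _]] := Clifford_basis irrG simS.
have all_iso S1 S2 : mxsimple rA S1 -> mxsimple rA S2 -> mx_iso rA S1 S2.
  move=> simS1 simS2; have [W1 isoS1] := Socle_iso sA simS1.
  have [W2 isoS2] := Socle_iso sA simS2.
  have eqW : W1 = W2.
    apply/eqP/contraT => neW; have := primG sA cAA.
    by rewrite leqNgt (cardD1 W1) (cardD1 W2) !inE eq_sym neW.
  rewrite -eqW in isoS2.
  exact: mx_iso_trans (mx_iso_sym isoS1) isoS2.
have: (1%:M%R <= rfix_mx rG [set x])%MS.
  rewrite -defX; apply/sumsmx_subP => g /sXG Gg.
  have [f _ homf defSg] := all_iso S _ simS (Clifford_simple simS Gg).
  rewrite -defSg; apply/rfix_mxP=> _ /set1P->.
  have hf y : y \in A -> (S *m rA y *m f = S *m f *m rA y)%R by move: y;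
    apply/hom_mxP.
  have eS := rstab_act Ux sSU.
  by have := hf x Ax; rewrite eS /= => <-.
by rewrite -rfix_mx_rstabC ?sub1set.
Qed.

Lemma primitive_cyclic (A : {group gT}) : A <| G -> abelian A -> cyclic A.
Proof.
move=> nsAG cAA; pose rA := subg_repr rG (normal_sub nsAG).
have n_gt0 : 0 < n by case/mx_irrP: irrG.
have [V simV] := ex_mxsimple rA n_gt0.
have modV := mxsimple_module simV; have [_ nzV _] := simV.
apply: (mx_faithful_irr_abelian_cyclic (rG := submod_repr modV)) (cAA) => //.
  by rewrite /mx_faithful rker_submod (primitive_rstab_abelian cAA modV).
exact/submod_mx_irr.
Qed.

(** [central_cyclic_bound] is applied to a simple [B]-submodule, on which [A] is still faithful by
    [primitive_rstab_abelian]. *)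
Lemma primitive_card_leq (A E B : {group gT}) :
    A <| G -> B <| G -> abelian A -> A \subset 'Z(B) -> E \subset B ->
    [~: B, E] \subset A -> 'C_B(E) \subset A ->
  exists k, #|B : A| <= k ^ 2 /\ #|A|.+1 ^ k <= #|F| ^ n.
Proof.
move=> nsAG nsBG cAA sAZ sEB sBEA sCA; have sBG := normal_sub nsBG.
have sAB : A \subset B := subset_trans sAZ (center_sub B).
pose rB := subg_repr rG sBG.
have n_gt0 : 0 < n by case/mx_irrP: irrG.
have [V simV] := ex_mxsimple rB n_gt0.
have modV := mxsimple_module simV.
have [|||k [leBA leV]] := @central_cyclic_bound _ _ A E B _ (submod_repr modV)
  _ _ sAZ sEB _ sBEA sCA.
- exact/submod_mx_irr.
- exact: primitive_cyclic.
- rewrite rker_submod; apply/trivgP; have [_ nzV _] := simV.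
  have modAV : mxmodule (subg_repr rG (normal_sub nsAG)) V.
    by apply/mxmoduleP=> x Ax; apply: (mxmoduleP modV); apply: (subsetP sAB).
  rewrite -(primitive_rstab_abelian cAA modAV nzV).
  by apply/subsetP=> x /setIP[Ax /setIdP[_ Vx]]; rewrite inE Ax.
exists k; split=> //; apply: leq_trans leV _.
by rewrite leq_exp2l ?rank_leq_row // finNzRing_gt1.
Qed.

End Primitive.

Lemma cube_leq_expn3 k : k ^ 3 <= 3 ^ k.
Proof.
elim: k => // -[|[|[|k]]] // IHk; rewrite expnS.
apply: leq_trans (leq_mul (leqnn 3) IHk).
rewrite !expnS expn0; nia.
Qed.

Lemma sqr_ltn_expn3 k : k ^ 2 < 3 ^ k.
Proof.
elim: k => // -[|k] // IHk; rewrite expnS.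
have {IHk} := IHk; rewrite !expnS expn0 => IHk; nia.
Qed.

(** * The order bound in the primitive case *)

Section PrimitiveBound.
Variables (F : finFieldType) (gT : finGroupType) (G : {group gT}) (n : nat).
Variable rG : mx_representation F G n.
Hypothesis bound : irr_bound (#|F| ^ n).
Hypotheses (solG : solvable G) (irrG : mx_irreducible rG) (ffulG :
  mx_faithful rG).
Hypothesis primG : forall (A : {group gT}) (nsAG : A <| G)
  (sA : socleType (subg_repr rG (normal_sub nsAG))),
    abelian A -> #|{: sA}| <= 1.

Variable A : {group gT}.
Hypothesis maxA : [max A | (A <| G) && abelian A].

Let nsAG : A <| G. Proof. by have /maxgroupp/andP[] := maxA. Qed.
Let cAA : abelian A. Proof. by have /maxgroupp/andP[] := maxA. Qed.
Let sAG := normal_sub nsAG.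
Let nAG := normal_norm nsAG.
Let cycA : cyclic A := primitive_cyclic irrG ffulG primG nsAG cAA.
Let C := 'C_G(A)%G.
Let nsCG : C <| G.
Proof. by rewrite /normal subsetIl normsI ?normG ?norms_cent. Qed.
Let sCG := normal_sub nsCG.
Let sAC : A \subset C. Proof. by rewrite subsetI sAG. Qed.

Let abelian_over (Z : {group gT}) : Z <| G -> A \subset Z -> abelian Z ->
  Z :=: A.
Proof.
by move=> nsZG sAZ cZZ; have [_ ->] := maxgroupP maxA; rewrite ?nsZG.
Qed.

Let sA_center (B : {group gT}) : A \subset B -> B \subset C -> A \subset 'Z(B).
Proof.
by move=> sAB; rewrite !subsetI sAB => /andP[_]; rewrite centsC.
Qed.

(** The action of an element on the cyclic group [A] is determined by the image of a generator,
    whose conjugacy class lies in [A]. *)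
Lemma index_cent_max_abelian : #|G : C| <= #|A|.
Proof.
have [a defA] := cyclicP cycA.
have -> : C :=: 'C_G[a] by rewrite /= defA cent_cycle.
rewrite index_cent1 subset_leq_card // class_sub_norm //.
by rewrite defA cycle_id.
Qed.

Lemma center_over (E : {group gT}) :
  E <| G -> A \subset E -> E \subset C -> 'Z(E) = A.
Proof.
move=> nsEG sAE sEC.
apply: (@abelian_over 'Z(E)%G); rewrite ?sA_center ?center_abelian //.
exact: gFnormal_trans.
Qed.

(** Both strict inequalities come from [B] being larger than [A]. If [A] were trivial, [E] would
    centralise [B], which would then lie in ['C_B(E)] and so in [A]. *)
Lemma card_leq_over (E B : {group gT}) :
    B <| G -> E <| G -> A \subset E -> E \subset B -> B \subset C ->
    [~: B, E] \subset A -> 'C_B(E) \subset A -> B :!=: A ->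
  exists k, [/\ 1 < k, 2 < #|A|.+1, #|B : A| <= k ^ 2 & #|A|.+1 ^ k <= #|F| ^
    n].
Proof.
move=> nsBG nsEG sAE sEB sBC sBEA sCA neBA; have sAB := subset_trans sAE sEB.
have [k [le_k leA]] := primitive_card_leq irrG ffulG primG nsAG nsBG cAA
  (sA_center sAB sBC) sEB sBEA sCA.
exists k; split=> //.
  rewrite ltnNge; apply: contra neBA => k_le1.
  rewrite eqEsubset sAB andbT -indexg_eq1 eqn_leq indexg_gt0 andbT (leq_trans
    le_k) //.
  by case: (k) k_le1 => [|[|]].
rewrite !ltnS ltnNge; apply: contra neBA => A_le1.
have A1 : A :=: 1 by apply: card_le1_trivg.
rewrite eqEsubset sAB andbT; apply: subset_trans sCA.
by rewrite subsetI subxx; apply/commG1P/trivgP; rewrite -A1.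
Qed.

(** [T / A] is a minimal normal subgroup of [G / A] inside [D / A]. As [[~: T, T] \subset A] and
    ['Z(T) = A], [card_leq_over] with [E = B = T] bounds the order of [T / A] by
    [k ^ 2 < 3 ^ k <= #|F| ^ n], which brings it within reach of the inductive bound. *)
Lemma chief_over (D : {group gT}) :
    D <| G -> A \subset D -> D \subset C -> D :!=: A ->
  exists T : {group gT},
    [/\ T <| G, A \proper T, T \subset D, abelian (T / A) &
        2 ^ 6 * #|G / A : 'C_(G / A)(T / A)| <= #|T / A| ^ 6].
Proof.
move=> nsDG sAD sDC neDA; have nsAD := normalS sAD (normal_sub nsDG) nsAG.
have ntD : D / A != 1.
  by rewrite -subG1 quotient_sub1 ?normal_norm // -[_ \subset _]andbT -sAD
    -eqEsubset.
have nDGq : G / A \subset 'N(D / A) by rewrite quotient_norms ?normal_norm.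
have [Tq minT sTD] := minnormal_exists ntD nDGq.
have solGq : solvable (G / A) := quotient_sol A solG.
have sTG : Tq \subset G / A := subset_trans sTD (quotientS A (normal_sub nsDG)).
have nsTGq : Tq <| G / A by rewrite /normal sTG; have /mingroupp/andP[] := minT.
have [T defT sAT nsTG] := inv_quotientN nsAG nsTGq.
have [_ ntT /is_abelemP[p _ /abelem_abelian cTT]] :=
  minnormal_solvable minT sTG solGq.
have sTG' := normal_sub nsTG.
have nsAT := normalS sAT sTG' nsAG.
have sTD' : T \subset D.
  by rewrite -(quotientSGK (normal_norm nsAT) sAD) -defT.
have neTA : T :!=: A.
  by apply: contraNneq ntT => TA; rewrite defT TA trivg_quotient.
have cTTq : abelian (T / A) by rewrite -defT.
have sTTA : [~: T, T] \subset A.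
  by rewrite -derg1 der1_min // normal_norm.
have sTC := subset_trans sTD' sDC.
have sCT : 'C_T(T) \subset A by rewrite -(center_over nsTG sAT sTC).
have [k [_ A_gt1 le_k leA]] := card_leq_over nsTG nsTG sAT (subxx T) sTC sTTA
  sCT neTA.
exists T; split=> //; first by rewrite properEneq eq_sym neTA.
have oT : #|T / A| = #|T : A| by rewrite card_quotient ?normal_norm.
rewrite -defT; apply: (minnormal_bound bound) => //.
rewrite defT oT; apply: leq_ltn_trans le_k _; apply: leq_trans leA.
apply: leq_trans (sqr_ltn_expn3 k) _; case: (k) => // k'.
by rewrite leq_exp2r.
Qed.

(* The last condition is inherited from chief factors of G / A through the
   induction hypothesis; a maximal such E satisfies 'C_C(E) = A. *)
Let good (E : {group gT}) := [&& E <| G, A \proper E, E \subset C,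
  abelian (E / A) &
  2 ^ 6 * #|G / A : 'C_(G / A)(E / A)| <= #|E / A| ^ 6].

(** Otherwise [chief_over] gives [T] strictly above [A] inside ['C_C(E)]. Then [T :&: E] lies in
    ['Z(E) = A], so the orders of [T / A] and [E / A] multiply in [T <*> E], which is again good.
    Maximality puts [T] inside [E], hence inside [A]. *)
Lemma max_good_cent (E : {group gT}) : [max E | good E] -> 'C_C(E) = A.
Proof.
case/maxgroupP=> /and5P[nsEG /andP[sAE nsEA] sEC cEE boundE] maxE.
have nsDG : ('C_C(E))%G <| G.
  rewrite /normal subIset ?sCG //= normsI ?norms_cent ?normal_norm //.
have sAD : A \subset 'C_C(E) by rewrite subsetI sAC centsC (subset_trans sEC)
  ?subsetIr.
apply/eqP/contraT => neDA.
have [T [nsTG /andP[sAT not_sTA] sTD cTT boundT]] :=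
  chief_over nsDG sAD (subsetIl _ _) neDA.
have [sTC cET] : T \subset C /\ T \subset 'C(E) by apply/andP; rewrite -subsetI.
have nAE := subset_trans (normal_sub nsEG) nAG.
have nAT := subset_trans (normal_sub nsTG) nAG.
have tiTE : T :&: E = A.
  apply/eqP; rewrite eqEsubset subsetI sAT sAE andbT -(center_over nsEG sAE
    sEC).
  by rewrite subsetI subsetIr subIset ?cET.
have defTEq : (T <*> E) / A = (T / A) * (E / A).
  by rewrite norm_joinEr ?quotientMl // cents_norm // centsC.
have goodTE : good (T <*> E)%G.
  rewrite /good normalY //= (proper_sub_trans _ (joing_subl T E)) ?join_subG
    ?sTC ?sEC //=; last by rewrite properE sAT.
  rewrite defTEq abelianM cTT cEE quotient_cents 1?centsC //=.
  have -> : 'C_(G / A)((T / A) * (E / A)) = 'C_(G / A)(T / A) :&: 'C_(G / A)(E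
    / A).
    by rewrite centM -setIIr.
  have tiq : (T / A) :&: (E / A) = 1 by rewrite -quotientIG // tiTE
    trivg_quotient.
  rewrite (TI_cardMg tiq) expnMn.
  have le_idx := leq_index_setI (subsetIl (G / A) 'C(T / A)) (subsetIl (G / A)
    'C(E / A)).
  apply: leq_trans (leq_mul (leqnn _) le_idx) _.
  apply: leq_trans (leq_mul boundT boundE).
  by rewrite mulnACA leq_pmul2r ?muln_gt0 ?indexg_gt0.
have eqTE := maxE _ goodTE (joing_subr T E).
case/negP: not_sTA; rewrite -tiTE subsetI subxx.
by have := joing_subl T E; rewrite (eqTE : T <*> E = E).
Qed.

Lemma primitive_bound : 2 ^ 6 * #|G| <= (#|F| ^ n) ^ 6.
Proof.
have oG : #|G| = (#|G : C| * #|C|)%N by rewrite mulnC Lagrange.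
(* If [A] is its own centraliser, then [#|G| <= a ^ 2] with [a = #|A|], and
   [2 ^ 6 * a ^ 2 <= (4 * a) ^ 3 <= a.+1 ^ 6]. *)
have [defC | neCA] := eqVneq (C : {set gT}) A.
  have sAA : A \subset 'Z(A) by rewrite subsetI subxx.
  have sAAA : [~: A, A] \subset A by rewrite commg_subl normG.
  have [k [le_k leA]] := primitive_card_leq irrG ffulG primG nsAG nsAG cAA sAA
    (subxx A) sAAA (subsetIl _ _).
  have k_gt0 : 0 < k by case: (k) le_k; rewrite ?indexgg.
  have leA1 : #|A|.+1 <= #|F| ^ n.
    by apply: leq_trans leA; rewrite -{1}[_.+1]expn1 leq_pexp2l.
  have le6 : #|A|.+1 ^ 6 <= (#|F| ^ n) ^ 6 by rewrite leq_exp2r.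
  apply: leq_trans le6; rewrite oG (_ : #|C| = #|A|); last by rewrite defC.
  apply: leq_trans (leq_mul (leqnn _) (leq_mul index_cent_max_abelian (leqnn
    _))) _.
  have := cardG_gt0 A; move: #|A| => a a_gt0.
  have le4 : 4 * a <= a.+1 ^ 2 by have [+ _] := nat_AGM2 a 1;
    rewrite muln1 addn1.
  have : (4 * a) ^ 3 <= (a.+1 ^ 2) ^ 3 by rewrite leq_exp2r.
  rewrite -expnM; apply: leq_trans.
  by rewrite expnMn mulnn leq_mul // leq_pexp2l.
have [T [nsTG pAT sTC cTT boundT]] := chief_over nsCG sAC (subxx _) neCA.
have goodT : good T by apply/and5P.
have [E maxE _] := maxgroup_exists goodT.
have defA := max_good_cent maxE.
have /and5P[nsEG /andP[sAE nsEA] sEC cEE boundE] := maxgroupp maxE.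
have nAE := subset_trans (normal_sub nsEG) nAG.
(* This choice of [B] gives [[~: B, E] \subset A], while ['C_B(E)] lies in ['C_C(E) = A]. *)
pose Bq := 'C_(C / A)(E / A)%G; pose B := (coset A @*^-1 Bq)%G.
have sBqC : Bq \subset C / A := subsetIl _ _.
have sAB : A \subset B := sub_cosetpre Bq.
have defBq : B / A = Bq by rewrite /= cosetpreK.
have nAB : B \subset 'N(A) := subsetIl _ _.
have sBC : B \subset C.
  by rewrite -(quotientSGK nAB sAC) defBq.
have nsBG : B <| G.
  rewrite -(quotientGK nsAG) cosetpre_normal /= /normal subIset ?quotientS //=.
  by rewrite normsI ?norms_cent ?quotient_norms ?normal_norm.
have sEB : E \subset B.
  by rewrite -(quotientSGK nAE sAB) defBq subsetI quotientS.
have sBEA : [~: B, E] \subset A.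
  by rewrite -quotient_cents2 // defBq subsetIr.
have sCA : 'C_B(E) \subset A by rewrite -defA setSI.
have neBA : B :!=: A by apply: contraNneq nsEA => <-.
have [k [k_gt1 A_gt1 le_k leA]] := card_leq_over nsBG nsEG sAE sEB sBC sBEA sCA
  neBA.
have le_idx : 2 ^ 6 * #|C : B| <= (k ^ 2) ^ 6.
  have -> : #|C : B| = #|C / A : B / A|.
    by rewrite index_quotient_eq // ?(subset_trans sCG) // subIset ?sAB ?orbT.
  have le1 : #|C / A : B / A| <= #|G / A : 'C_(G / A)(E / A)|.
    have -> : B / A = (C / A) :&: 'C_(G / A)(E / A).
      by rewrite defBq setIA (setIidPl (quotientS A sCG)).
    exact: leq_index_capr (quotientS A sCG).
  apply: leq_trans (leq_mul (leqnn _) le1) _; apply: leq_trans boundE _.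
  rewrite leq_exp2r //; apply: leq_trans le_k.
  by rewrite -card_quotient // subset_leq_card // quotientS.
have oC : #|C| = (#|C : B| * (#|B : A| * #|A|))%N.
  by rewrite mulnA Lagrange_index // mulnC Lagrange.
have le6 : (#|A|.+1 ^ k) ^ 6 <= (#|F| ^ n) ^ 6 by rewrite leq_exp2r.
apply: leq_trans le6; rewrite oG oC.
have := index_cent_max_abelian; move: le_idx le_k A_gt1.
move: #|C : B| #|B : A| #|G : C| #|A| => i j c a le_i le_j a_gt1 le_c.
(* The factors [#|G : C|] and [#|A|] give [a ^ 2]; [#|B : A|] gives [k ^ 2], and [2 ^ 6 * #|C : B|]
   gives [k ^ 12]. With [y = a.+1 ^ k], [k > 1] yields [a ^ 2 <= y], and [a > 1] yields [k ^ 14 <=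
   (k ^ 3) ^ 5 <= (3 ^ k) ^ 5 <= y ^ 5]. *)
have le_y : a ^ 2 <= a.+1 ^ k.
  by apply: leq_trans (leq_pexp2l _ k_gt1) => //; rewrite leq_exp2r.
have le_kk : k ^ 14 <= (a.+1 ^ k) ^ 5.
  apply: leq_trans (_ : (k ^ 3) ^ 5 <= _).
    by rewrite -expnM leq_pexp2l // ltnW.
  rewrite leq_exp2r //; apply: leq_trans (cube_leq_expn3 k) _.
  by rewrite leq_exp2r // ltnW.
rewrite [X in _ <= X]expnS; apply: leq_trans (leq_mul le_y le_kk).
rewrite (mulnC j) (mulnCA i) (mulnA c) mulnCA [(2 ^ 6 * _)%N]mulnA.
apply: leq_mul; first by rewrite expnS expn1 leq_mul2r le_c orbT.
by rewrite (_ : 14 = 2 * 6 + 2)%N // expnD expnM leq_mul.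
Qed.

End PrimitiveBound.

(** Induction on the bound for the order of the module, after passing to the faithful quotient. If
    the inequality failed, [imprimitive_bound] would leave at most one homogeneous component for
    each normal subgroup, and [primitive_bound] would then prove it. *)
Theorem irr_order_bound m : irr_bound m.
Proof.
elim: {m}_.+1 {-2}m (ltnSn m) => // m' IHm m; rewrite ltnS => lemm'.
move=> F gT G n rG solG irrG ltm.
have bound : irr_bound (#|F| ^ n) by apply: IHm; apply: leq_trans lemm'.
pose rK := kquo_repr rG.
have irrK : mx_irreducible rK by apply/quo_mx_irr.
have ffulK : mx_faithful rK := kquo_mx_faithful rG.
have solK : solvable (G / rker rG) by apply: quotient_sol.
rewrite -card_quotient ?rker_norm //.
apply: contraT => not_bound.
have [|A maxA] := @ex_maxgroup _ (fun A => (A <| G / rker rG) && abelian A).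
  by exists 1%G; rewrite normal1 abelian1.
case/negP: (not_bound).
apply: (primitive_bound bound solK irrK ffulK _ maxA) => B nsB sB _.
rewrite leqNgt; apply: contra not_bound.
exact: imprimitive_bound.
Qed.

(** * Complements of a minimal normal subgroup *)

Lemma minnormal_cent_index (gT : finGroupType) (G N : {group gT}) :
    solvable G -> minnormal N G -> N \subset G ->
  2 ^ 6 * #|G : 'C_G(N)| <= #|N| ^ 6.
Proof.
by move=> solG minN sNG; apply: (minnormal_bound (@irr_order_bound #|N|.+1)).
Qed.

Section Complements.
Variables (gT : finGroupType) (G N : {group gT}).
Hypotheses (solG : solvable G) (minN : minnormal N G) (sNG : N \subset G).
Local Notation C := ('C_G(N)).

Let nsNG : N <| G.
Proof. by rewrite /normal sNG; have /mingroupp/andP[] := minN. Qed.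
Let nNG := normal_norm nsNG.
Let nsCG : C <| G.
Proof. by rewrite /normal subsetIl normsI ?normG ?norms_cent. Qed.

Lemma minnormal_abelian : abelian N.
Proof.
have [_ _ /is_abelemP[p _]] := minnormal_solvable minN sNG solG.
exact: abelem_abelian.
Qed.

Let sNC : N \subset C. Proof. by rewrite subsetI sNG;
  exact: minnormal_abelian. Qed.

Lemma minnormal_cap (X : {group gT}) : G \subset 'N(X) ->
  N :&: X = 1 \/ N \subset X.
Proof.
move=> nXG; have [-> | ntNX] := eqVneq (N :&: X) 1; [by left | right].
have [_ min1] := mingroupP minN.
have <- : N :&: X = N; last exact: subsetIr.
by apply: (min1 (N :&: X)%G); rewrite ?subsetIl // ntNX normsI.
Qed.

(** * A single complement [M] and its trace on ['C_G(N)] *)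

Section OneComplement.
Variable M : {group gT}.
Hypotheses (maxM : maximal M G) (notNM : ~~ (N \subset M)).

Let sMG : M \subset G := proper_sub (maxgroupp maxM).

Lemma complement_mul : M * N = G.
Proof. exact: mul_maximal_normal. Qed.

(** The intersection is normalised by [M] and centralised by the abelian group [N], so minimality of
    [N] applies. *)
Lemma complement_cap : N :&: M = 1.
Proof.
have nNMG : G \subset 'N(N :&: M).
  rewrite -complement_mul mul_subG //.
    by rewrite normsI ?normG // (subset_trans sMG).
  by rewrite cents_norm // centsC subIset //; apply/orP; left;
    exact: minnormal_abelian.
have [|sNM] := @minnormal_cap (N :&: M)%G nNMG; first by rewrite setIA setIid.
by case/negP: notNM; apply: subset_trans sNM (subsetIr _ _).
Qed.

Lemma complement_index : #|G : M| = #|N|.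
Proof.
apply/eqP; rewrite -(eqn_pmul2l (cardG_gt0 M)) Lagrange // -TI_cardMg.
  by rewrite complement_mul.
by rewrite setIC complement_cap.
Qed.

Lemma complement_core_normal : M :&: C <| G.
Proof.
rewrite /normal subIset ?sMG //= -{1}complement_mul mul_subG //.
  by rewrite normsI ?normG // (subset_trans sMG) // normal_norm.
by rewrite cents_norm // centsC setIA subsetIr.
Qed.

Lemma complement_core_mul : (M :&: C) * N = C.
Proof. by rewrite setIC group_modr // complement_mul (setIidPl _) ?subsetIl.
  Qed.

Lemma complement_core_cap : N :&: (M :&: C) = 1.
Proof. by rewrite setIA complement_cap (setIidPl _) ?sub1G. Qed.

(** The quotient of [C] by [M :&: C] is a copy of [N], hence a chief factor: Dedekind's law recovers
    [X] from [N :&: X]. *)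
Lemma complement_core_chief (X : {group gT}) :
  G \subset 'N(X) -> M :&: C \subset X -> X \subset C ->
    X :=: M :&: C \/ X :=: C.
Proof.
move=> nXG sDX sXC.
have defX : X :=: (M :&: C) * (N :&: X).
  by rewrite group_modl // complement_core_mul (setIidPr sXC).
have [NX1 | sNX] := minnormal_cap nXG.
  by left; rewrite defX NX1 mulg1.
by right; rewrite defX (setIidPl sNX) complement_core_mul.
Qed.

Lemma complement_core_der : C^`(1) \subset M :&: C.
Proof.
have nDN : N \subset 'N(M :&: C) := subset_trans sNG (normal_norm
  complement_core_normal).
rewrite der1_min ?(normal_norm (normalS _ (subsetIl _ _)
  complement_core_normal)) ?subsetIr //.
have := quotientMidl (M :&: C)%G N; rewrite [_ * _]complement_core_mul /= => ->.
by rewrite quotient_abelian //; exact: minnormal_abelian.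
Qed.

Lemma complement_core_card : (#|M :&: C| * #|N| = #|C|)%N.
Proof. by rewrite -TI_cardMg ?complement_core_mul // setIC complement_core_cap.
  Qed.

End OneComplement.

(** * Two complements: conjugacy, or a new maximal subgroup *)

Section TwoComplements.
Variables M1 M2 : {group gT}.
Hypotheses (maxM1 : maximal M1 G) (notNM1 : ~~ (N \subset M1)).
Hypotheses (maxM2 : maximal M2 G) (notNM2 : ~~ (N \subset M2)).

Let sM1G : M1 \subset G := proper_sub (maxgroupp maxM1).
Let sM2G : M2 \subset G := proper_sub (maxgroupp maxM2).

(** The two traces have equal order, so the join of distinct ones is strictly above [M2 :&: C], and
    [complement_core_chief] leaves only [C]. *)
Lemma join_complement_cores : M1 :&: C != M2 :&: C ->
  (M1 :&: C) * (M2 :&: C) = C.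
Proof.
move=> neD; have nsD1 := complement_core_normal maxM1 notNM1.
have nsD2 := complement_core_normal maxM2 notNM2.
have nD12 := subset_trans (normal_sub nsD1) (normal_norm nsD2).
have nJ : G \subset 'N((M2 :&: C) <*> (M1 :&: C))
  by rewrite normsY ?normal_norm.
have [||eqJ|eqJ] := complement_core_chief maxM2 notNM2 (X :=
  ((M2 :&: C) <*> (M1 :&: C))%G) nJ.
- exact: joing_subl.
- by rewrite join_subG !subsetIr.
- case/eqP: neD; apply/eqP; rewrite eqEcard -{1}eqJ joing_subr /=.
  have N_gt0 := cardG_gt0 N.
  by rewrite -(leq_pmul2r N_gt0) (complement_core_card maxM1 notNM1)
    (complement_core_card maxM2 notNM2).
- by rewrite -norm_joinEl // joingC.
Qed.

Lemma complement_core_supplement :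
  M1 :&: C != M2 :&: C -> (M1 :&: C) * (M1 :&: M2) = M1.
Proof.
move=> neD; have nsD1 := complement_core_normal maxM1 notNM1.
have nsD2 := complement_core_normal maxM2 notNM2.
suffices defG : (M1 :&: C) * M2 = G.
  by rewrite [M1 :&: M2]setIC group_modl ?subsetIl // defG (setIidPr sM1G).
apply/eqP; rewrite eqEsubset mul_subG ?(normal_sub nsD1) //=.
have defC : (M2 :&: C) * (M1 :&: C) = C.
  by rewrite -(normC (subset_trans (normal_sub nsD1) (normal_norm nsD2)))
    join_complement_cores.
have <- : M2 * C = (M1 :&: C) * M2.
  transitivity (M2 * ((M2 :&: C) * (M1 :&: C))); first by rewrite defC.
  by rewrite mulgA mulGSid ?subsetIl // (normC (subset_trans sM2G (normal_norm
    nsD1))).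
by apply: subset_trans (mulgS M2 sNC); rewrite complement_mul.
Qed.

(** A subgroup [T] above [(M1 :&: M2) <*> N] is determined by [X = T :&: M1 :&: C]. This [X] is
    normal in [G], so [(M2 :&: C) <*> X] is [M2 :&: C] or [C]. *)
Lemma maximal_mul_cap : M1 :&: C != M2 :&: C -> maximal ((M1 :&: M2) <*> N) G.
Proof.
move=> neD; have nsD1 := complement_core_normal maxM1 notNM1.
have nsD2 := complement_core_normal maxM2 notNM2.
have defM1 := complement_core_supplement neD.
pose I := (M1 :&: M2)%G.
have nNI : I \subset 'N(N) by rewrite subIset // (subset_trans sM1G).
have sNL : N \subset I <*> N := joing_subr _ _.
have dedekind (T : {group gT}) : N \subset T -> T \subset G ->
  T :=: (T :&: M1) * N.
  by move=> sNT sTG; rewrite group_modr // (complement_mul maxM1) // (setIidPl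
    sTG).
have capL : (I <*> N) :&: M1 = I.
  by rewrite norm_joinEl // -group_modl ?subsetIl // (complement_cap maxM1)
    ?mulg1.
apply/maxgroupP; split.
  rewrite properE join_subG subIset ?sM1G //= sNG /=.
  apply: contra neD => sGL.
  have sM12 : M1 \subset M2.
    by rewrite -(setIidPl (subset_trans sM1G sGL)) setIC capL subsetIr.
  have [_ maxM1'] := maxgroupP maxM1.
  by have -> : M2 = M1 :> {set gT} by apply: maxM1' sM12;
    exact: (maxgroupp maxM2).
move=> T /[dup] pTG /proper_sub sTG; rewrite join_subG => /andP[sIT sNT].
pose X := ((T :&: M1) :&: C)%G.
have sXD1 : X \subset M1 :&: C by rewrite setSI ?subsetIr.
(* [G] is generated by [M1 :&: C], [M1 :&: M2] and [N]. The first normalises [X] because the derived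
   subgroup of [C] lies in both [M1] and [M2], hence in [X]; the second because it lies in [T]; the
   third centralises [X]. *)
have nXG : G \subset 'N(X).
  rewrite -(complement_mul maxM1 notNM1) mul_subG //; last first.
    by rewrite cents_norm // centsC (subset_trans (subsetIr _ _)) ?subsetIr.
  rewrite -defM1 mul_subG //.
    rewrite -commg_subl.
    apply: subset_trans (commgSS (subsetIr _ _ :
      X \subset C) (subsetIr M1 C)) _.
    have der1 := complement_core_der maxM1 notNM1.
    have der2 := complement_core_der maxM2 notNM2.
    have der1M1 := subset_trans der1 (subsetIl _ _).
    have der2M2 := subset_trans der2 (subsetIl _ _).
    apply/subsetIP; split; last exact: der_sub 1%N C.
    apply/subsetIP; split=> //; apply: subset_trans sIT.
    exact/subsetIP.
  have nTM1 : I \subset 'N(T :&: M1).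
    by rewrite (subset_trans _ (normG _)) // subsetI sIT subsetIl.
  by rewrite normsI // (subset_trans (subset_trans (subsetIl M1 M2) sM1G)) //
    normal_norm.
have defTM1 : T :&: M1 = X * I.
  by rewrite -{1}defM1 -group_modr //= setIA.
have nJ : G \subset 'N((M2 :&: C) <*> X) by rewrite normsY ?(normal_norm nsD2).
have nXD2 : X \subset 'N(M2 :&: C).
  by rewrite (subset_trans sXD1) // (subset_trans (normal_sub nsD1)) //
    normal_norm.
have sXC : X \subset C := subsetIr _ _.
(* If the join is [M2 :&: C], then [X] lies in [M2] and [T] is no larger than [I <*> N]. If it is
   [C], then [T] contains [M1 :&: C], hence [M1], hence [G]. *)
have [||eqJ|eqJ] := complement_core_chief maxM2 notNM2 (X :=
  ((M2 :&: C) <*> X)%G) nJ.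
- exact: joing_subl.
- by rewrite join_subG subsetIr.
- have sTL : T \subset I <*> N.
    rewrite norm_joinEl // {1}(dedekind T sNT sTG) mulSg // defTM1 mul_subG //.
    rewrite subsetI (subset_trans sXD1) ?subsetIl //.
    by apply: subset_trans (subsetIl M2 C); have := joing_subr (M2 :&: C) X;
      rewrite (eqJ : (M2 :&: C) <*> X = M2 :&: C).
  by apply/eqP; rewrite eqEsubset sTL join_subG sIT sNT.
case/negP: (proper_subn pTG); rewrite -(complement_mul maxM1 notNM1) mul_subG
  // -defM1 mul_subG //.
have : M1 :&: C \subset (M2 :&: C) * X by rewrite -norm_joinEr // (eqJ :
  (M2 :&: C) <*> X = C) subsetIr.
move/setIidPr; rewrite -normC // -group_modl //= => <-.
rewrite mul_subG //; first exact: subset_trans (subsetIl _ _) (subsetIl _ _).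
by apply: subset_trans sIT; rewrite setIC setISS ?subsetIl.
Qed.

(** For a minimal normal subgroup [L / C] of [G / C], the groups [(L :&: M1) / D] and
    [(L :&: M2) / D] are Sylow subgroups of [L / D], hence conjugate. Each complement is recovered
    as the normaliser in [G] of its intersection with [L]. *)
Lemma complements_conj : M1 :&: C = M2 :&: C -> exists2 v,
  v \in N & M2 :=: M1 :^ v.
Proof.
move=> eqD; set D := (M1 :&: C)%G.
have nsDG : D <| G := complement_core_normal maxM1 notNM1.
have nDG := normal_norm nsDG.
have sDM1 : D \subset M1 by exact: subsetIl.
have sDM2 : D \subset M2 by rewrite [gval D]eqD subsetIl.
have [defC | neCG] := eqVneq C G.
  exists 1; rewrite ?group1 // conjsg1.
  by rewrite -(setIidPl sM1G) -(setIidPl sM2G) -defC eqD.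
have sCG : C \subset G := normal_sub nsCG.
have ntGC : G / C != 1.
  by rewrite -subG1 quotient_sub1 ?normal_norm // -[_ \subset _]andTb -sCG
    -eqEsubset.
have [Lq minL sLG] := minnormal_exists ntGC (normG _).
have solGq : solvable (G / C) := quotient_sol _ solG.
have nsLq : Lq <| G / C by rewrite /normal sLG; have /mingroupp/andP[] := minL.
have [L defL sCL nsLG] := inv_quotientN nsCG nsLq.
have [_ ntL /is_abelemP[r r_pr /abelem_pgroup rL]] :=
  minnormal_solvable minL sLG solGq.
have [_ ntN /is_abelemP[p p_pr abelN]] := minnormal_solvable minN sNG solG.
(* A faithful irreducible module in characteristic [p] forces ['O_p(G / C) = 1]. *)
have r'p : p != r.
  apply: contraNneq ntL => pr.
  have irrN : mx_irreducible (abelem_repr abelN ntN nNG)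
    by apply/abelem_mx_irrP.
  have irrq : mx_irreducible (kquo_repr (abelem_repr abelN ntN nNG))
    by apply/quo_mx_irr.
  have Opq := pcore_faithful_mx_irr_pchar (pchar_Fp p_pr) irrq
    (kquo_mx_faithful _).
  have [K defK Op] : exists2 K : {group gT}, K :=: C & 'O_p(G / K) = 1.
    by exists (rker_group (abelem_repr abelN ntN nNG)); rewrite //= rker_abelem.
  have eqKC : K = 'C_G(N)%G by apply: val_inj.
  rewrite {K defK}eqKC in Op.
  by rewrite -subG1 -Op pcore_max // pr.
have sLG' := normal_sub nsLG; have sNL := subset_trans sNC sCL.
have sDC : D \subset C := subsetIr _ _.
have nsDL : D <| L := normalS (subset_trans sDC sCL) sLG' nsDG.
(* Comparing orders, [(L :&: M) / D] has the order of [L / C], a power of [r], and its index in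
   [L / D] is [#|N|], a power of [p]. *)
have sylow (M : {group gT}) : maximal M G -> ~~ (N \subset M) -> M :&: C = D ->
    [/\ (L :&: M) * N = L, L :&: M :&: C = D & r.-Sylow(L / D) ((L :&: M) / D)].
  move=> maxM notNM MC_D; have sMG := proper_sub (maxgroupp maxM).
  have defLM : (L :&: M) * N = L.
    by rewrite group_modr // (complement_mul maxM) // (setIidPl sLG').
  have LMC : L :&: M :&: C = D.
    by rewrite setIAC (setIidPr sCL) setIC.
  have sDLM : D \subset L :&: M by rewrite -LMC subsetIl.
  have nLMD : L :&: M \subset 'N(D) by rewrite subIset // normal_norm.
  have tiLMN : L :&: M :&: N = 1.
    by rewrite -setIA [M :&: N]setIC (complement_cap maxM) // (setIidPr _)
      ?sub1G.
  have oL : (#|L :&: M| * #|N| = #|L|)%N by rewrite -TI_cardMg // defLM.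
  have oC : (#|D| * #|N| = #|C|)%N := complement_core_card maxM1 notNM1.
  split=> //; apply/and3P; split; first by rewrite quotientS ?subsetIl.
    rewrite /pgroup card_quotient // -divgS //.
    rewrite -(divnMr (cardG_gt0 N)) oL oC divgS // -card_quotient ?normal_norm
      ?(normalS sCL sLG') //.
    by rewrite -defL.
  have iq : #|L / D : (L :&: M) / D| = #|L : L :&: M|.
    apply: index_quotient_eq (normal_norm nsDL); last exact: subsetIl.
    exact: subset_trans (subsetIr _ _) sDLM.
  rewrite iq.
  rewrite -divgS ?subsetIl // -oL mulKn //.
  by apply: pi_pnat (abelem_pgroup abelN) _; rewrite !inE.
have [defL1 capL1 sylL1] := sylow M1 maxM1 notNM1 (erefl _).
have [defL2 capL2 sylL2] := sylow M2 maxM2 notNM2 (esym eqD).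
have [xq /morphimP[y nDy Ly ->] defL2q] := Sylow_trans sylL1 sylL2.
(* The part [z] of the conjugating element normalises [L :&: M1], so the part [v] in [N] does the
   work. *)
have [z [v [L1z Nv defy]]] : exists z v, [/\ z \in L :&: M1,
  v \in N & y = z * v].
  by move: Ly; rewrite -{1}defL1 => /mulsgP[z v L1z Nv ->]; exists z, v.
have sDL1 : D \subset L :&: M1 by rewrite -capL1 subsetIl.
have sDL2 : D \subset L :&: M2 by rewrite -capL2 subsetIl.
have nDL : L \subset 'N(D) := normal_norm nsDL.
have nDv : v \in 'N(D) by rewrite (subsetP nDL) ?(subsetP sNL).
have defL2' : L :&: M2 = (L :&: M1) :^ v.
  have sDL1v : D \subset (L :&: M1) :^ v by rewrite -(normP nDv) conjSg.
  have nDL1v : (L :&: M1) :^ v \subset 'N(D).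
    by rewrite -(normP nDv) normJ conjSg subIset ?nDL.
  have nDL2 : L :&: M2 \subset 'N(D) by rewrite subIset ?nDL.
  apply: (quotient_inj (H := D) _ _ _).
  - by rewrite /normal sDL2.
  - by rewrite /normal sDL1v.
  rewrite /= defL2q quotientJ // defy.
  have [Lz _] := setIP L1z; have Lv := subsetP sNL v Nv.
  rewrite morphM ?(subsetP nDL) //.
  rewrite conjsgM (conjGid (mem_quotient D L1z)) -quotientJ //.
exists v => //.
have nL2 (M : {group gT}) : M \subset G -> M \subset 'N(L :&: M).
  by move=> sMG; rewrite normsI ?normG // (subset_trans sMG) ?normal_norm.
have Gv : v \in G := subsetP sNG v Nv.
have sM1vN : M1 :^ v \subset 'N_G(L :&: M2).
  by rewrite defL2' normJ -{1}(conjGid Gv) -conjIg conjSg subsetI sM1G nL2.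
(* If [L :&: M2] were normal in [G], it would either contain [N] or meet it trivially. In the second
   case it would centralise [N], and [L = (L :&: M2) * N] would lie in [C]. *)
have prN : 'N_G(L :&: M2) \proper G.
  rewrite properE subsetIl subsetI subxx /=; apply: contra ntL => nL2G.
  have [cL2 | sNL2] := minnormal_cap (X := (L :&: M2)%G) nL2G.
    have sL2C : L :&: M2 \subset C.
      have sL2G : L :&: M2 \subset G by rewrite subIset ?sLG'.
      have tiNL2 : [~: N, L :&: M2] \subset N :&: (L :&: M2).
        apply: commg_subI; apply/subsetIP; split=> //.
          exact: subset_trans sNG nL2G.
        exact: subset_trans sL2G nNG.
      rewrite subsetI sL2G centsC; apply/commG1P/trivgP.
      by rewrite (cL2 : N :&: (L :&: M2) = 1) in tiNL2.
    rewrite defL -subG1 quotient_sub1 ?(subset_trans sLG' (normal_norm nsCG))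
      //.
    by rewrite -defL2 mul_subG.
  by case/negP: notNM2; apply: subset_trans sNL2 (subsetIr _ _).
have [_ maxM2'] := maxgroupP maxM2.
have defN : 'N_G(L :&: M2) = M2.
  by apply: (maxM2' 'N_G(L :&: M2)%G) => //; rewrite subsetI sM2G nL2.
apply/esym/eqP; rewrite eqEcard -{1}defN sM1vN cardJg.
rewrite -(leq_pmul2r (cardG_gt0 N)) -{1}(complement_index maxM2 notNM2).
by rewrite -(complement_index maxM1 notNM1) (Lagrange sM1G) (Lagrange sM2G)
  leqnn.
Qed.

End TwoComplements.

End Complements.

(** Elementwise form of being an intersection of maximal subgroups; the whole group counts as the
    empty intersection. *)
Definition maximal_closed (gT : finGroupType) (H : {set gT}) := forall x,
  (forall M : {group gT}, maximal M [set: gT] -> H \subset M -> x \in M) ->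
    x \in H.

(* Condition (2) of a gamma-module for W = 'C_N(H), read in a finite quotient: s
   is a basis of W^*. *)
Definition centraliser_cap (gT : finGroupType) (N H : {set gT}) (s : seq gT) :=
  [/\ {subset s <= N}, {in s, forall w, 'C('C_N(H)) \subset 'C[w]} &
      forall x, {in s, forall w, x \in 'C[w]} ->
        (forall M : {group gT}, maximal M [set: gT] -> 'C('C_N(H)) \subset M ->
          x \in M) ->
        x \in 'C('C_N(H))].

(** If [x] lies in [M] and in [M :^ v], the commutator of [x] and [v^-1] lies in [N :&: M = 1]. *)
Lemma mem_conj_complement (gT : finGroupType) (N M : {group gT}) x v :
    [set: gT] \subset 'N(N) -> N :&: M = 1 -> v \in N -> x \in M ->
  x \in M :^ v = (x \in 'C[v]).
Proof.
move=> nN tiNM Nv Mx; apply/idP/idP=> [Mvx | /cent1P cxv]; last first.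
  by rewrite mem_conjg conjgE invgK mulgA -cxv mulgK.
rewrite -groupV in Nv.
have : [~ x, v^-1] \in N :&: M.
  apply/setIP; split; last by rewrite commgEl groupM ?groupV // -mem_conjg.
  have Nx : x \in 'N(N) by rewrite (subsetP nN) ?inE.
  by rewrite commgEr groupM // memJ_norm // groupV.
rewrite tiNM => /set1P/eqP/commgP/commuteV cxv.
by apply/cent1P; rewrite invgK in cxv.
Qed.

(** * Reduction modulo a minimal normal subgroup *)

Section Step.
Variables (gT : finGroupType) (N H M1 : {group gT}) (s : seq gT).
Hypotheses (solT : solvable [set: gT]) (minN : minnormal N [set: gT]).
Hypotheses (maxM1 : maximal M1 [set: gT]) (notNM1 : ~~ (N \subset M1)).
Hypotheses (sHM1 : H \subset M1) (capH : maximal_closed H).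
Hypothesis cent_s : centraliser_cap N H s.

(** A maximal subgroup above ['C('C_N(H))] contains [H] and [N], so [cent_s] puts [x] in
    ['C('C_N(H))]. A maximal [M] above [H] either contains [N], or is [M1 :^ v] with [v] in
    ['C_N(H)], or yields the maximal subgroup [(M1 :&: M) <*> N], whose intersection with [M1] is
    [M1 :&: M]. In each case [x] lies in [M]. *)
Lemma maximal_closed_step x :
    (forall M : {group gT}, maximal M [set: gT] -> H <*> N \subset M ->
      x \in M) ->
    x \in M1 -> {in s, forall w, x \in M1 :^ w} ->
  x \in H.
Proof.
move=> HNx M1x sx; have sNT := subsetT N.
have nN : [set: gT] \subset 'N(N) by have /mingroupp/andP[] := minN.
have tiNM1 := complement_cap solT minN sNT maxM1 notNM1.
have cNN : abelian N := minnormal_abelian solT minN sNT.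
have [sN cW cap_s] := cent_s.
have cWx : x \in 'C('C_N(H)).
  apply: cap_s => [w sw | M maxM sCM].
    by rewrite -(mem_conj_complement nN tiNM1) ?sN ?sx.
  apply: HNx => //; apply: subset_trans sCM.
  by rewrite join_subG !(centsC _ ('C_N(H))) subsetIr subIset ?[N \subset _]cNN.
apply: capH => M maxM sHM; have [sNM | notNM] := boolP (N \subset M).
  by apply: HNx; rewrite ?join_subG ?sHM.
have [eqD | neD] := eqVneq (M1 :&: 'C_([set: gT])(N)) (M :&: 'C_([set: gT])(N)).
  have [v Nv defM] := complements_conj solT minN sNT maxM1 notNM1 maxM notNM
    eqD.
  have cHv : v \in 'C_N(H).
    rewrite inE Nv; apply/centP=> h Hh; apply/esym/cent1P.
    rewrite -(mem_conj_complement nN tiNM1) ?(subsetP sHM1) //.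
    by rewrite -defM (subsetP sHM).
  rewrite defM (mem_conj_complement nN tiNM1) //.
  by apply/cent1P; apply: (centP cWx).
have maxI := maximal_mul_cap solT minN sNT maxM1 notNM1 maxM notNM neD.
have Ix : x \in (M1 :&: M) <*> N.
  by apply: HNx maxI _; rewrite genS // setSU // subsetI sHM1.
have /setIP[] : x \in M1 :&: M => //.
have nNI : M1 :&: M \subset 'N(N) by apply: subset_trans nN.
rewrite norm_joinEl // in Ix.
have : x \in (M1 :&: M) * N :&: M1 by rewrite inE Ix.
by rewrite -group_modl ?subsetIl // tiNM1 mulg1.
Qed.

End Step.

Lemma cosetpre_setT (gT : finGroupType) (N : {group gT}) :
  [set: gT] \subset 'N(N) -> coset N @*^-1 [set: coset_of N] = [set: gT].
Proof.
move=> nN; apply/setP=> x; have := subsetP nN x.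
by rewrite !inE andbT => ->.
Qed.

(** * Short families of maximal subgroups, by induction on the group order *)

Section Induction.
Variables (gamma : nat) (Q : finGroupType -> Prop).
(* Q will be the class of continuous finite quotients of a profinite group. *)
Hypothesis Qsol : forall gT, Q gT -> solvable [set: gT].
Hypothesis Qquo : forall (gT : finGroupType) (N : {group gT}),
  [set: gT] \subset 'N(N) -> Q gT -> Q (coset_of N).
Hypothesis Qcent : forall (gT : finGroupType) (N M H : {group gT}),
  Q gT -> minnormal N [set: gT] -> maximal M [set: gT] -> ~~ (N \subset M) ->
  exists2 s, size s <= gamma & centraliser_cap N H s.

(** The quotient by [N] accounts for the factor [#|[set: gT] : H <*> N|] of the index. The subgroup
    [M1] and its at most [gamma] conjugates cost at most [#|N| ^ gamma.+1], and [#|N|] is the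
    remaining factor. *)
Lemma short_maximal_family (gT : finGroupType) (H : {group gT}) :
    Q gT -> maximal_closed H ->
  exists s : seq {group gT},
    [/\ {in s, forall M : {group gT}, maximal M [set: gT] /\ H \subset M},
        forall x, {in s, forall M : {group gT}, x \in M} -> x \in H &
        \prod_(M <- s) #|[set: gT] : M| <= #|[set: gT] : H| ^ gamma.+1].
Proof.
move: {2}_.+1 (ltnSn #|gT|) => n; elim: n => // n IHn in gT H *.
rewrite ltnS => le_gT QgT capH.
have [ntT | ntT] := eqVneq [set: gT] 1.
  exists [::]; split=> // [x _|]; last by rewrite big_nil expn_gt0 indexg_gt0.
  by have := in_setT x; rewrite ntT => /set1P->.
have [N minN _] := minnormal_exists ntT (normG _).
have [ntN nN] : N :!=: 1 /\ [set: gT] \subset 'N(N).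
  by have /mingroupp/andP[] := minN.
have nNA (A : {set gT}) : A \subset 'N(N) by apply: subset_trans nN;
  apply: subsetT.
have nsN (A : {group gT}) : N \subset A -> N <| A by move=> sNA;
  rewrite /normal sNA nNA.
have preT := cosetpre_setT nN.
pose P (M : {group coset_of N}) := maximal M [set: coset_of N] && (H / N
  \subset M).
(* [H / N] need not be an intersection of maximal subgroups, so the induction is applied to the
   intersection of those above it; its index is no larger. *)
pose Hq := bigcap_group P (fun M : {group coset_of N} => M).
have capHq : maximal_closed Hq.
  move=> x Hx; apply/bigcapP=> M PM; case/andP: (PM) => maxM _.
  by apply: Hx => //; apply: bigcap_inf.
have lt_q : #|{: coset_of N}| < n.
  apply: leq_trans le_gT; rewrite -!cardsT -(quotientT N) ltn_quotient ?subsetT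
    //.
have [s' [max_s' cap_s' le_s']] := IHn _ _ lt_q (Qquo nN QgT) capHq.
have sHHq : H / N \subset Hq by apply/bigcapsP=> M /andP[].
pose pre (M : {group coset_of N}) := (coset N @*^-1 M)%G.
have max_pre M : maximal (pre M) [set: gT] = maximal M [set: coset_of N].
  by rewrite -preT cosetpre_maximal.
have idx_pre (M : {group coset_of N}) : #|[set: gT] :
  pre M| = #|[set: coset_of N] : M|.
  by rewrite -preT index_cosetpre.
have sHpre (M : {group coset_of N}) : H / N \subset M -> H \subset pre M.
  by move=> sHM; rewrite -sub_quotient_pre.
have max_s1 : {in map pre s', forall M : {group gT},
  maximal M [set: gT] /\ H \subset M}.
  move=> _ /mapP[M /max_s'[maxM sHM] ->]; rewrite max_pre; split=> //.
  by rewrite sHpre // (subset_trans sHHq).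
have cap_s1 x : {in map pre s', forall M : {group gT}, x \in M} ->
    forall M : {group gT}, maximal M [set: gT] -> H <*> N \subset M -> x \in M.
  move=> s1x M maxM; rewrite join_subG => /andP[sHM sNM].
  have Hqx : coset N x \in Hq.
    apply: cap_s' => M' s'M'; have /s1x := map_f pre s'M'.
    by rewrite !inE => /andP[].
  have PM : P (M / N)%G.
    rewrite /P quotientS // andbT -(quotientT N) quotient_maximal ?nsN //.
    exact: subsetT.
  have /bigcapP/(_ _ PM) Mx := Hqx.
  by rewrite -(quotientGK (nsN M sNM)) mem_morphpre // -sub1set nNA.
have idx_s1 : \prod_(M <- map pre s') #|[set: gT] :
  M| <= #|[set: coset_of N] : Hq| ^ gamma.+1.
  by rewrite big_map (eq_bigr _ (fun M _ => idx_pre M)).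
(* If every maximal subgroup above [H] contains [N], then so does [H], and the family pulled back
   from the quotient suffices. *)
have [/existsP[M1 /and3P[maxM1 sHM1 notNM1]] | noM1] :=
  boolP [exists M1 : {group gT},
   [&& maximal M1 [set: gT], H \subset M1 & ~~ (N \subset M1)]]; last first.
  have sNH : N \subset H.
    apply/subsetP=> x Nx; apply: capH => M maxM sHM.
    apply: contraR noM1 => notMx; apply/existsP; exists M; rewrite maxM sHM.
    by apply: contra notMx => /subsetP->.
  exists (map pre s'); split=> // [x s1x|].
    apply: capH => M maxM sHM; apply: (cap_s1 x s1x M maxM).
    by rewrite join_subG sHM (subset_trans sNH).
  apply: leq_trans idx_s1 _; rewrite leq_exp2r // -idx_pre.
  by apply: dvdn_leq => //; apply: indexgS; apply: sHpre.
have [s size_s cent_s] := Qcent H QgT minN maxM1 notNM1.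
have [sN cW _] := cent_s.
pose conjM1 w := (M1 :^ w)%G.
exists (map pre s' ++ M1 :: map conjM1 s).
have solT := Qsol QgT; have tiNM1 := complement_cap solT minN (subsetT N) maxM1
  notNM1.
have oM1 := complement_index solT minN (subsetT N) maxM1 notNM1.
split.
- move=> M; rewrite mem_cat inE => /or3P[/max_s1 // | /eqP-> // | /mapP[w sw
  ->]] /=.
  split; first by rewrite -(conjTg w) maximalJ.
  apply/subsetP=> h Hh; rewrite (mem_conj_complement nN tiNM1) ?sN ?(subsetP
    sHM1) //.
  apply: (subsetP (cW w sw)); apply/centP=> v /setIP[_ /centP cHv].
  exact/commute_sym/cHv.
- move=> x sx; apply: (maximal_closed_step solT minN maxM1 notNM1 sHM1 capH
  cent_s).
  + by apply: cap_s1 => M s1M; apply: sx; rewrite mem_cat s1M.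
  + by apply: sx; rewrite mem_cat inE eqxx orbT.
  + by move=> w sw; apply: (sx (conjM1 w)); rewrite mem_cat inE (map_f conjM1)
    ?orbT.
have prod_s : (\prod_(M <- map conjM1 s) #|[set: gT] : M| = #|N| ^ size s)%N.
  rewrite big_map (eq_bigr (fun=> #|N|)); last first.
    by move=> w _; rewrite -oM1 -{1}(conjTg w) indexJg.
  by rewrite big_const_seq count_predT iter_muln_1.
rewrite big_cat big_cons /= prod_s oM1 -expnS.
have le_e : #|N| ^ (size s).+1 <= #|N| ^ gamma.+1 by rewrite leq_pexp2l.
apply: leq_trans (leq_mul idx_s1 le_e) _.
rewrite -expnMn leq_exp2r //.
have tiHN : H :&: N = 1.
  by rewrite setIC; apply/trivgP; rewrite -tiNM1 setIS.
have sHHN := joing_subl H N.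
rewrite -(Lagrange_index (subsetT (H <*> N)%G) sHHN) leq_mul //.
  rewrite -idx_pre; apply: dvdn_leq => //; apply: indexgS.
  by rewrite -sub_quotient_pre // quotientYidr.
by rewrite -divgS //= norm_joinEl // TI_cardMg // mulKn.
Qed.

End Induction.

(** * Centralisers in a complement [K] of subsets of [N] *)

Section ComplementCentraliser.
Variables (gT : finGroupType) (N K : {group gT}) (W : {set gT}).
Hypotheses (solT : solvable [set: gT]) (minN : minnormal N [set: gT]).
Hypotheses (maxK : maximal K [set: gT]) (notNK : ~~ (N \subset K)).
Hypothesis sWN : W \subset N.

Let nN : [set: gT] \subset 'N(N). Proof. by have /mingroupp/andP[] := minN. Qed.
Let cNN : abelian N := minnormal_abelian solT minN (subsetT N).
Let tiNK : N :&: K = 1 := complement_cap solT minN (subsetT N) maxK notNK.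
Let prodKN : K * N = [set: gT].
Proof. by apply: mul_maximal_normal; rewrite // /normal subsetT. Qed.
Let H := 'C_K(W)%G.

Lemma complement_centraliser_closed : maximal_closed H.
Proof.
move=> x Hx; have Kx : x \in K by apply: Hx => //; apply: subsetIl.
rewrite inE Kx; apply/centP=> w Ww; apply/cent1P.
have Nw := subsetP sWN w Ww.
rewrite -(mem_conj_complement nN tiNK) //; apply: (Hx (K :^ w)%G).
  by rewrite -(conjTg w) maximalJ.
apply/subsetP=> h /setIP[Kh /centP cWh].
by rewrite (mem_conj_complement nN tiNK) //; apply/cent1P/cWh.
Qed.

(** One factor [#|N|] is the index of [K]. The other six bound the index of ['C(N)], which is
    contained in ['C(W)]. *)
Lemma complement_centraliser_index : #|[set: gT] : H| <= #|N| ^ 7.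
Proof.
have oK := complement_index solT minN (subsetT N) maxK notNK.
rewrite -(Lagrange_index (subsetT K) (subsetIl K 'C(W))) oK expnS leq_mul2l.
apply/orP; right.
have le6 := minnormal_cent_index solT minN (subsetT N); rewrite setTI in le6.
apply: leq_trans (leq_trans (leq_pmull _ _) le6) => //.
apply: leq_trans (leq_index_capr 'C(W)%G (subsetT K)) _.
by apply: dvdn_leq => //; apply: indexgS; rewrite centS.
Qed.

Lemma cent_complement_mul : H * N = 'C(W).
Proof.
have cWN : N \subset 'C(W) by apply: subset_trans (centS sWN).
by rewrite -[gval H]/('C_K(W)) setIC group_modr // prodKN ?setIT.
Qed.

(** Members of [s] not containing [N] contain ['C_K(N)], so they have the same trace on ['C(N)] as
    [K] and are conjugate to it by elements of [N]. These elements form [vs], and each accounts for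
    a factor [#|N|] of the product. *)
Lemma complement_family (s : seq {group gT}) :
    {in s, forall M : {group gT}, maximal M [set: gT] /\ H \subset M} ->
    (forall x, {in s, forall M : {group gT}, x \in M} -> x \in H) ->
  exists vs : seq gT,
    [/\ {subset vs <= N}, #|N| ^ size vs <= \prod_(M <- s) #|[set: gT] : M|,
        {in vs, forall v, 'C(W) \subset 'C[v]} &
        forall x, {in vs, forall v, x \in 'C[v]} ->
          (forall M : {group gT}, maximal M [set: gT] -> 'C(W) \subset M ->
            x \in M) ->
          x \in 'C(W)].
Proof.
move=> max_s cap_s.
pose f (M : {group gT}) := odflt 1 [pick v in N | M :==: K :^ v].
have fP M : M \in s -> ~~ (N \subset M) -> f M \in N /\ M :=: K :^ f M.
  move=> sM notNM; have [maxM sHM] := max_s M sM.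
  suffices eqD : K :&: 'C_([set: gT])(N) = M :&: 'C_([set: gT])(N).
    have [v Nv defM] := complements_conj solT minN (subsetT N) maxK notNK maxM
      notNM eqD.
    by rewrite /f; case: pickP => [w /andP[Nw /eqP] // | /(_ v)];
      rewrite Nv defM eqxx.
  apply/eqP; rewrite eqEcard; apply/andP; split.
    rewrite !setTI subsetI subsetIr andbT; apply: subset_trans sHM.
    by rewrite setIS // centS.
  have N_gt0 := cardG_gt0 N.
  by rewrite -(leq_pmul2r N_gt0) !(complement_core_card solT minN (subsetT N)).
pose s1 := [seq M : {group gT} <- s | ~~ (N \subset M)].
have s1P M : M \in s1 -> [/\ M \in s, maximal M [set: gT], H \subset M,
  ~~ (N \subset M) & f M \in N /\ M :=: K :^ f M].
  by rewrite mem_filter => /andP[notNM sM]; have [] := max_s M sM; split=> //;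
    apply: fP.
have cHf M : M \in s1 -> H \subset 'C[f M].
  case/s1P=> _ _ sHM _ [Nf defM]; apply/subsetP=> h Hh.
  have /setIP[Kh _] := Hh.
  by rewrite -(mem_conj_complement nN tiNK) // -defM (subsetP sHM).
exists (map f s1); split.
- by move=> _ /mapP[M /s1P[_ _ _ _ []] Nf _ ->].
- rewrite size_map (bigID (fun M : {group gT} => N \subset M)) /= mulnC.
  rewrite -big_filter -/s1 big_seq (eq_bigr (fun=> #|N|)); last first.
    by move=> M /s1P[_ maxM _ notNM _]; exact: (complement_index solT minN
      (subsetT N) maxM notNM).
  rewrite -big_seq big_const_seq count_predT iter_muln_1 leq_pmulr // prodn_gt0
    //.
- move=> _ /mapP[M s1M ->]; rewrite -cent_complement_mul mul_subG ?cHf //.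
  have [_ _ _ _ [Nf _]] := s1P M s1M.
  by rewrite sub_cent1; apply: subsetP Nf.
move=> x vsx Wx.
have : x \in K * N by rewrite prodKN inE.
(* The part [n] centralises both [W] and [vs], so it is enough to put [k] in every member of [s]. *)
case/mulsgP=> k n Kk Nn defx.
rewrite -cent_complement_mul defx mem_mulg //; apply: cap_s => M sM.
have [maxM sHM] := max_s M sM.
have [sNM | notNM] := boolP (N \subset M).
  have -> : k = x * n^-1 by rewrite defx mulgK.
  rewrite groupM ?groupV ?(subsetP sNM n) //; apply: Wx => //.
  by rewrite -cent_complement_mul mul_subG.
have s1M : M \in s1 by rewrite mem_filter notNM.
have [Nf ->] := fP M sM notNM.
rewrite (mem_conj_complement nN tiNK) //.
have -> : k = x * n^-1 by rewrite defx mulgK.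
rewrite groupM ?groupV ?vsx ?map_f //.
by apply/cent1P; apply: (centsP cNN).
Qed.

End ComplementCentraliser.

Require Import Defs.
From mathcomp Require Import finmap all_classical all_reals all_analysis.

Import Order.TTheory Num.Theory.

Local Open Scope classical_set_scope.
Local Open Scope group_scope.

(** * Finite quotients of a profinite group *)

Section TopologicalGroups.
Variable G : topologicalGroupType.
Implicit Types H K : set G.

Lemma subgroupV H x : subgroup H -> H x -> H x^-1.
Proof. by move=> [H1 Hdiv] Hx; rewrite -[x^-1]mul1g; apply: Hdiv. Qed.

Lemma subgroupM H x y : subgroup H -> H x -> H y -> H (x * y).
Proof.
by move=> sH Hx Hy; rewrite -[y]invgK; apply: sH.2 => //; apply: subgroupV.
Qed.

Lemma open_ltranslate H g : open H -> open [set x | H (g * x)].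
Proof.
move=> oH; have cg : continuous (fun x : G => g * x).
  move=> x; apply: (@continuous_comp _ _ _ (fun y : G => (g, y)) (fun p =>
    p.1 * p.2)).
    by apply: cvg_pair; [exact: cvg_cst | exact: cvg_id].
  exact: mulg_continuous.
by move/continuousP : cg; apply.
Qed.

Lemma open_rtranslate H g : open H -> open [set x | H (x * g)].
Proof.
move=> oH; have cg : continuous (fun x : G => x * g).
  move=> x; apply: (@continuous_comp _ _ _ (fun y : G => (y, g)) (fun p =>
    p.1 * p.2)).
    by apply: cvg_pair; [exact: cvg_id | exact: cvg_cst].
  exact: mulg_continuous.
by move/continuousP : cg; apply.
Qed.

Lemma open_subgroup_sub H K : subgroup H -> open H -> subgroup K ->
  H `<=` K -> open K.
Proof.
move=> sH oH sK sHK.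
have -> : K = \bigcup_(k in K) [set x | H (k^-1 * x)].
  apply/seteqP; split=> [x Kx | x [k Kk /= Hkx]].
    by exists x => //=; rewrite mulVg; case: sH.
  by rewrite -[x](mulKVg k); apply: subgroupM => //; apply: sHK.
by apply: bigcup_open => k _; apply: open_ltranslate.
Qed.

End TopologicalGroups.

Section Profinite.
Variable G : profiniteGroupType.
Implicit Types H K : set G.

Definition coset_set H (x : G) := [set x * h | h in H].

Lemma coset_setP H x y : subgroup H -> coset_set H x y <-> H (x^-1 * y).
Proof.
move=> sH; split=> [[h Hh <-] | Hxy]; first by rewrite mulKg.
by exists (x^-1 * y) => //; rewrite mulKVg.
Qed.

Lemma coset_set_eq H x y : subgroup H -> (coset_set H x = coset_set H y) <-> H
  (x^-1 * y).
Proof.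
move=> sH; split=> [eqC | Hxy].
  by apply/coset_setP => //; rewrite eqC; apply/coset_setP => //;
    rewrite mulVg; case: sH.
apply/seteqP; split=> z /(coset_setP _ _ sH) Hz; apply/(coset_setP _ _ sH).
  by rewrite -[z](mulKVg x) mulgA; apply: subgroupM => //;
    rewrite -[_ * _]invgK invMg invgK; apply: subgroupV.
by rewrite -[z](mulKVg y) mulgA; apply: subgroupM.
Qed.

Lemma finite_cosets H : subgroup H -> open H ->
  finite_set [set coset_set H x | x in [set: G]].
Proof.
move=> sH oH.
(* The covering form of compactness is used on a pointed space; the identity serves as the point. *)
pose pG : ptopologicalType := HB.pack_for ptopologicalType G (isPointed.Build G
  1).
have := @profinite_compact G; rewrite (compact_cover pG) => cG.
have [|g _|D' _ covD] := cG G [set: G] (fun g => [set x | H (g^-1 * x)]).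
- by move=> g _; apply: open_ltranslate.
- by exists g => //=; rewrite mulVg; case: sH.
apply: (@sub_finite_set _ _ [set coset_set H x | x in [set` D']]).
  move=> _ [x _ <-]; have [g D'g /= Hgx] := covD x I.
  by exists g => //; apply/coset_set_eq.
exact/finite_image/finite_fset.
Qed.

End Profinite.

Section FiniteQuotients.
Variable G : profiniteGroupType.
Implicit Types H K : set G.

(** A continuous epimorphism onto a discrete finite group; continuity is expressed by the open
    kernel. *)
Definition finite_quotient (gT : finGroupType) (f : G -> gT) :=
  [/\ {morph f : x y / x * y}, open [set x | f x = 1] & forall y, exists x,
    f x = y].

(** [T] indexes the left cosets of [H], [mk] maps an element to its coset and [r] chooses
    representatives. *)
Lemma coset_type H : subgroup H -> open H ->
  exists (T : finType) (mk : G -> T) (r : T -> G),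
    cancel r mk /\ forall x y, mk x = mk y <-> H (x^-1 * y).
Proof.
move=> sH oH; have finC := finite_cosets sH oH.
pose S := fset_set [set coset_set H x | x in [set: G]].
have memS x : coset_set H x \in S.
  by rewrite in_fset_set // inE; exists x.
have repS (c : S) : exists x, coset_set H x = val c.
  by case: c => c /=; rewrite in_fset_set // inE => -[x _ <-]; exists x.
exists S, (fun x => [` memS x]%fset), (fun c => projT1 (cid (repS c))).
split=> [c | x y]; first by apply: val_inj => /=; case: cid.
rewrite -(coset_set_eq x y sH); split=> [[//] | eqC].
exact: val_inj.
Qed.

Lemma open_forall_fin (T : finType) (P : T -> set G) :
  (forall c, open (P c)) -> open [set g | forall c, P c g].
Proof.
move=> oP; suff oPs (s : seq T) : open [set g | forall c, c \in s -> P c g].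
  have := oPs (enum T); congr open; apply/seteqP.
  by split=> g /= Pg c; [apply: Pg; rewrite mem_enum | move=> _].
elim: s => [|c s IHs].
  rewrite (_ : mkset _ = setT); first exact: openT.
  by apply/seteqP; split=> g _ //= c; rewrite in_nil.
rewrite (_ : mkset _ = P c `&` [set g | forall c, c \in s -> P c g]).
  exact: openI.
apply/seteqP; split=> [g Pg | g [Pcg Psg] d].
  by split=> [|d sd]; apply: Pg; rewrite inE ?eqxx ?sd ?orbT.
by rewrite inE => /orP[/eqP-> | /Psg].
Qed.

(* The action of G on the cosets of H, corestricted to its image. *)
Lemma finite_quotient_exists H : subgroup H -> open H ->
  exists (gT : finGroupType) (f : G -> gT),
    finite_quotient f /\ forall g, f g = 1 <-> forall x, H (x^-1 * g * x).
Proof.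
move=> sH oH; have [T [mk [r [rK mkP]]]] := coset_type sH oH.
pose act g c := mk (g * r c).
have mkr x : mk (r (mk x)) = mk x by rewrite rK.
have mkM g x y : mk x = mk y -> mk (g * x) = mk (g * y).
  by move/mkP=> Hxy; apply/mkP; rewrite invgM -mulgA mulKg.
have actM g h c : act (g * h) c = act g (act h c).
  by rewrite /act -mulgA; apply: mkM; rewrite mkr.
have act1 c : act 1 c = c by rewrite /act mul1g rK.
have actK g : cancel (act g^-1) (act g) by move=> c; rewrite -actM mulgV act1.
(* [phi g] acts as [g^-1]: permutations compose from left to right, so the inverse makes [phi] a
   morphism. *)
pose phi g : {perm T} := perm (can_inj (actK g)).
have phiM : {morph phi : x y / x * y}.
  by move=> x y; apply/permP=> c; rewrite permM !permE -actM invgM.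
have phi1 : phi 1 = 1 by apply/permP=> c; rewrite permE perm1 invg1 act1.
pose I := [set s : {perm T} | `[< exists g, phi g = s >]]%SET.
have gI : group_set I.
  apply/group_setP; split=> [|s t]; first by rewrite inE; apply/asboolP;
    exists 1.
  rewrite ![_ \in I]inE => /asboolP Is /asboolP It; apply/asboolP.
  by case: Is It => g <- [h <-]; exists (g * h).
pose IG := Group gI.
have Iphi g : phi g \in IG by rewrite inE; apply/asboolP; exists g.
have kerT g : phi g = 1 <-> forall c, H ((r c)^-1 * (g * r c)).
  split=> [phig1 c | Hg].
    have := congr1 (fun s : {perm T} => s c) phig1;
      rewrite permE perm1 /act -{2}[c]rK.
    by move/mkP; rewrite invgM invgK -mulgA.
  apply/permP=> c; rewrite permE perm1 /act -[RHS]rK; apply/mkP.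
  by rewrite invgM invgK -mulgA.
have kerP g : phi g = 1 <-> forall x, H (x^-1 * g * x).
  rewrite kerT; split=> [Hg x | Hg c]; last by rewrite mulgA.
  have Hx : H (x^-1 * r (mk x)) by apply/mkP; rewrite mkr.
  have := subgroupM sH (subgroupM sH Hx (Hg (mk x))) (subgroupV sH Hx).
  by rewrite invgM invgK !mulgA !mulgK.
exists (subg_of IG), (fun g => subg IG (phi g)); split; last first.
  move=> g; rewrite -kerP; split=> [/(congr1 val) | ->];
    last exact: (morph1 (subg_morphism IG)).
  by rewrite /= subgK.
split=> [x y | | y].
- by rewrite phiM subgM.
(* Restricting to coset representatives makes the kernel a finite intersection of translates of
   [H]. *)
- rewrite (_ : mkset _ = [set g | forall c, H ((r c)^-1 * (g * r c))]).
    apply: open_forall_fin => c.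
    exact: (open_rtranslate (H := [set x | H ((r c)^-1 * x)]) _
      (open_ltranslate _ oH)).
  apply/seteqP; split=> g /=.
    by move/(congr1 val); rewrite /= subgK // => /kerT.
  by move/kerT->; exact: (morph1 (subg_morphism IG)).
have := subgP y; rewrite inE => /asboolP[g phig]; exists g.
by rewrite phig sgvalK.
Qed.

End FiniteQuotients.

(** * Subgroups of a finite quotient and their preimages *)

Section Correspondence.
Variables (G : profiniteGroupType) (gT : finGroupType) (f : G -> gT).
Hypothesis qf : finite_quotient f.
Implicit Types (H K : set G) (A B M : {group gT}).

Let fM : {morph f : x y / x * y}. Proof. by case: qf. Qed.

Lemma quot1 : f 1 = 1.
Proof. by apply: (mulgI (f 1)); rewrite -fM !mulg1. Qed.

Lemma quotV x : f x^-1 = (f x)^-1.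
Proof. by apply: (mulgI (f x)); rewrite -fM !mulgV quot1. Qed.

Definition pre (A : {set gT}) : set G := [set x | f x \in A].

Lemma subgroup_pre A : subgroup (pre A).
Proof.
split=> [|x y]; rewrite /pre /=; first by rewrite quot1 group1.
by move=> Ax Ay; rewrite fM quotV groupM ?groupV.
Qed.

Lemma subgroup_ker : subgroup [set x | f x = 1].
Proof.
by split=> [|x y /= fx fy]; rewrite /= ?quot1 // fM quotV fx fy invg1 mulg1.
Qed.

Lemma ker_pre A : [set x | f x = 1] `<=` pre A.
Proof. by move=> x /= fx; rewrite /pre /= fx group1. Qed.

Lemma open_pre A : open (pre A).
Proof.
case: qf => _ oker _.
exact: open_subgroup_sub subgroup_ker oker (subgroup_pre A) (@ker_pre A).
Qed.

Lemma sub_pre (A B : {set gT}) : (pre A `<=` pre B) <-> A \subset B.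
Proof.
case: qf => _ _ surj; split=> [sAB | /fintype.subsetP sAB x]; last exact: sAB.
by apply/fintype.subsetP=> y Ay; have [x fx] := surj y; have := sAB x;
  rewrite /pre /= fx; apply.
Qed.

Lemma pre_inj (A B : {set gT}) : pre A = pre B -> A = B.
Proof.
move=> eqAB; apply/eqP; rewrite finset.eqEsubset.
by apply/andP; split; apply/sub_pre; rewrite eqAB.
Qed.

Lemma preT : pre [set: gT]%SET = [set: G].
Proof. by apply/seteqP; split=> x //= _; rewrite /pre /= inE. Qed.

Lemma pre_surj K : subgroup K -> [set x | f x = 1] `<=` K -> exists A,
  K = pre A.
Proof.
move=> sK kerK; pose I := [set y : gT | `[< exists x, K x /\ f x = y >]]%SET.
have gI : group_set I.
  apply/group_setP; split=> [|y z].
    by rewrite inE; apply/asboolP; exists 1; split; [case: sK | exact: quot1].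
  rewrite ![_ \in I]inE => /asboolP Iy /asboolP Iz; apply/asboolP.
  case: Iy Iz => x [Kx <-] [x' [Kx' <-]]; exists (x * x').
  by split=> //; apply: subgroupM.
exists (Group gI); apply/seteqP; split=> x.
  by move=> Kx; rewrite /pre /= inE; apply/asboolP; exists x.
rewrite /pre /= inE => /asboolP [x' [Kx' eqf]].
rewrite -[x](mulKVg x'); apply: subgroupM => //; apply: kerK => /=.
by rewrite fM quotV eqf mulVg.
Qed.

Lemma maximal_pre M : maximal_subgroup (pre M) <-> maximal M [set: gT]%SET.
Proof.
split=> [[_ _ neT maxM] | maxM].
  apply/maxgroupP; split=> [|A pAT sMA].
    rewrite properT; apply: contraNneq neT => ->; exact/eqP/preT.
  have [/pre_inj // | eqT] := maxM (pre A) (subgroup_pre A) ((sub_pre _ _).2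
    sMA).
  by case/negP: (proper_subn pAT); apply/sub_pre; rewrite eqT.
have [pMT maxM'] := maxgroupP maxM.
split; [exact: subgroup_pre | exact: open_pre | |].
  apply/eqP => eqT; case/negP: (proper_subn pMT); apply/sub_pre.
  by rewrite eqT.
move=> K sK sMK; have [A defK] := pre_surj sK (subset_trans (@ker_pre M) sMK).
rewrite {}defK in sMK *; have /sub_pre sMA := sMK.
have [AT | pAT] := eqVneq (A : {set gT}) [set: gT]%SET; first by right;
  rewrite AT preT.
by left; rewrite (maxM' A) // properT.
Qed.

Lemma maximal_pre_surj K : maximal_subgroup K -> [set x | f x = 1] `<=` K ->
  exists2 M : {group gT}, maximal M [set: gT]%SET & K = pre M.
Proof.
move=> maxK kerK; have [sK _ _ _] := maxK; have [M defK] := pre_surj sK kerK.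
by exists M => //; apply/maximal_pre; rewrite -defK.
Qed.

Lemma index_pre A : subgroup_index (pre A) = #|[set: gT]%SET : A|.
Proof.
case: qf => _ _ surj.
have prel x : [set x * h | h in pre A] = pre (lcoset A (f x)).
  apply/seteqP; split=> [_ [h Ah <-] | y].
    by rewrite /pre /= fM lcosetE mem_lcoset mulKg.
  rewrite /pre /= lcosetE mem_lcoset => Axy; exists (x^-1 * y);
    last by rewrite mulKVg.
  by rewrite /pre /= fM quotV.
rewrite /subgroup_index -card_lcosets.
rewrite [X in fset_set X](_ : _ = [set` [fset pre C | C in lcosets A [set:
  gT]%SET]%fset]).
  rewrite set_fsetK card_in_imfset //= ?cardE // => C D _ _; exact: pre_inj.
apply/seteqP; split=> [_ [x _ <-] | C /imfsetP[D /lcosetsP[y _ ->] ->]].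
  apply/imfsetP; exists (lcoset A (f x)); last exact: prel.
  by apply/lcosetsP; exists (f x); rewrite ?inE ?lcosetE.
by have [x fx] := surj y; exists x => //=; rewrite prel fx lcosetE.
Qed.

Lemma finite_quotient_coset (N : {group gT}) : [set: gT]%SET \subset 'N(N) ->
  finite_quotient (coset N \o f).
Proof.
move=> nN; case: qf => _ _ surj.
have Nf x : f x \in 'N(N) by apply: (fintype.subsetP nN); rewrite inE.
split=> [x y | | y] /=.
- by rewrite fM morphM.
- rewrite (_ : mkset _ = pre N); first exact: open_pre.
  apply/seteqP; split=> x; rewrite /pre /=.
    exact: coset_idr (Nf x).
  exact: coset_id.
have [z Nz ->] := cosetP y; have [x fx] := surj z.
by exists x; rewrite fx.
Qed.

Lemma prosolvable_quotient : prosolvable G -> solvable [set: gT]%SET.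
Proof.
case: qf => _ oker surj solG.
pose phi : {multiplicative G -> gT} := HB.pack f (isMultiplicative.Build G gT f
  fM).
apply: (solG gT phi) => //; apply/seteqP; split=> // y _.
by have [x fx] := surj y; exists x.
Qed.

End Correspondence.

(** * Chief factors as modules *)

Section ModuleFacts.
Variables (G : topologicalGroupType) (V : finZmodType) (A : gmodule G V).
Local Open Scope ring_scope.

Lemma gact0 g : A g 0 = 0.
Proof. by apply: (addrI (A g 0)); rewrite -gactD !addr0. Qed.

Lemma gactN g v : A g (- v) = - A g v.
Proof. by apply: (addrI (A g v)); rewrite -gactD !subrr gact0. Qed.

Lemma gact_sum g (I : finType) (F : I -> V) :
  A g (\sum_i F i) = \sum_i A g (F i).
Proof. exact: (big_morph (A g) (gactD A g) (gact0 g)). Qed.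

Lemma F_subspace_fix (H : set G) : F_subspace A [set v | forall g,
  H g -> A g v = v].
Proof.
split; first split=> [g Hg|u v Hu Hv g Hg]; first exact: gact0.
  by rewrite gactD gactN Hu ?Hv.
by move=> c Fc v Hv g Hg; rewrite -Fc Hv.
Qed.

Lemma centraliser_basis W d (b : 'I_d -> V) g : F_basis A W b ->
  (forall i, A g (b i) = b i) -> centraliser A W g.
Proof.
move=> [_ span _] gb w /span[c Fc ->]; rewrite gact_sum; apply: eq_bigr => i _.
by rewrite -Fc gb.
Qed.

End ModuleFacts.

Section FactorModule.
Variables (G : profiniteGroupType) (gT : finGroupType) (f : G -> gT).
Hypothesis qf : finite_quotient f.
Variables (N : {group gT}) (V : finZmodType) (A : gmodule G V) (p : G -> V).
Hypothesis pD : forall x y, pre f N x -> pre f N y -> p (x * y) = (p x + p y)%R.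
Hypothesis p0 : forall x, pre f N x -> (p x = 0%R <-> pre f 1 x).
Hypothesis pT : p @` pre f N = [set: V].
Hypothesis pJ : forall g x, pre f N x -> p (g * x * g^-1) = A g (p x).
Hypothesis nN : [set: gT]%SET \subset 'N(N).

Let fM : {morph f : x y / x * y}. Proof. by case: qf. Qed.

Lemma factor_eq x y : pre f N x -> pre f N y -> p x = p y <-> f x = f y.
Proof.
move=> Nx Ny; have Nxy : pre f N (x * y^-1) by apply: (subgroup_pre qf N).2.
have px : p x = (p (x * y^-1)%g + p y)%R by rewrite -pD // mulgVK.
have fxy : f (x * y^-1) = f x * (f y)^-1 by rewrite fM (quotV qf).
split=> [eqp | eqf].
  have /(p0 Nxy) : p (x * y^-1)%g = 0%R.
    by apply: (GRing.addIr (p y)); rewrite -px eqp add0r.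
  by rewrite /pre /= fxy => /finset.set1P/eqP; rewrite -eq_mulgV1 => /eqP.
rewrite px (p0 Nxy).2 ?add0r // /pre /= fxy eqf mulgV; exact: group1.
Qed.

Lemma factor_conj g x : pre f N x -> pre f N (g * x * g^-1).
Proof.
rewrite /pre /= => Nx; rewrite !fM (quotV qf).
have Ng : (f g)^-1 \in 'N(N) by rewrite groupV (fintype.subsetP nN) ?inE.
by rewrite -[_ * _ * _]mulgA -{1}[f g]invgK -conjgE memJ_norm.
Qed.

Lemma factor_act_fix g x : pre f N x -> (A g (p x) = p x <-> f g \in 'C[f x]).
Proof.
move=> Nx; rewrite -pJ // factor_eq //; last exact: factor_conj.
rewrite !fM (quotV qf); split=> [eqx | /cent1P cgx].
  by apply/cent1P; rewrite /commute -{2}eqx mulgKV.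
by rewrite cgx mulgK.
Qed.

Lemma factor_lift v : exists2 x, pre f N x & p x = v.
Proof. have : (p @` pre f N) v by rewrite pT.
by case=> x Nx <-; exists x. Qed.

(** Under the projection [p], the fixed points of [H] in [V] correspond to ['C_N(H)], and fixing
    [p x] means commuting with [f x]. *)
Lemma centraliser_fix (H : {group gT}) :
  centraliser A [set v | forall g, pre f H g -> A g v = v] = pre f 'C('C_N(H)).
Proof.
have [_ _ surj] := qf.
apply/seteqP; split=> g /=.
  move=> cg; rewrite /pre /=; apply/centP=> y /finset.setIP[Ny /centP cHy].
  have [x fx] := surj y; rewrite -fx in Ny cHy *.
  apply/cent1P/factor_act_fix => //; apply: cg => h Hh.
  by apply/factor_act_fix => //; apply/cent1P/commute_sym/cHy.
move=> /centP cg w Hw; have [x Nx px] := factor_lift w; rewrite -px in Hw *.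
apply/factor_act_fix => //; apply/cent1P/cg; apply/finset.setIP; split=> //.
apply/centP=> h; have [k <-] := surj h => Hk.
by apply/commute_sym/cent1P/factor_act_fix => //; apply: Hw.
Qed.

End FactorModule.

(** * Minimal normal subgroups of finite quotients as chief factors *)

Section Quotients.
Variables (G : profiniteGroupType) (gT : finGroupType) (f : G -> gT).
Hypotheses (solG : prosolvable G) (qf : finite_quotient f).
Implicit Types (N M : {group gT}).

Let fM : {morph f : x y / x * y}. Proof. by case: qf. Qed.

Lemma normal_pre N : [set: gT]%SET \subset 'N(N) -> normal_subgroup (pre f N).
Proof.
move=> nN; split=> [|x g]; first exact: subgroup_pre.
rewrite /pre /= => Nx; rewrite conjgE !fM (quotV qf) -conjgE memJ_norm //.
by rewrite (fintype.subsetP nN) ?inE.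
Qed.

Lemma chief_factor_pre N : minnormal N [set: gT]%SET ->
  chief_factor (pre f N) (pre f 1).
Proof.
move=> minN; have /mingroupp/andP[ntN nN] := minN.
have n1 : [set: gT]%SET \subset 'N([1 gT]%G) by rewrite norm1 finset.subsetT.
split; last first.
  move=> X [sX nX] s1X sXN.
  have [A defX] := pre_surj qf sX (@subset_trans _ _ _ _ (@ker_pre _ _ f [1
    gT]%G) s1X).
  rewrite {}defX in nX s1X sXN *.
  have [A1 | ntA] := eqVneq (A : {set gT}) 1; [by left; rewrite A1 | right].
  have [_ minN'] := mingroupP minN; rewrite (minN' A) //;
    last exact/(sub_pre qf).
  rewrite ntA; apply/fintype.subsetP=> y _; rewrite inE;
    apply/fintype.subsetP=> _ /imsetP[z Az ->].
  have [_ _ surj] := qf; have [x fx] := surj z; have [g fg] := surj y.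
  have := nX x g; rewrite /pre /= conjgE !fM (quotV qf) fx fg -conjgE; exact.
split.
- exact: normal_pre.
- exact: open_pre.
- exact: (normal_pre (N := [1 gT]%G)).
- exact: (open_pre qf [1 gT]%G).
split; first by apply/(sub_pre qf); apply: sub1G.
by move/(sub_pre qf); rewrite subG1 (negPf ntN).
Qed.

Lemma complemented_pre N M : N :&: M = 1 -> (M * N)%g = [set: gT]%SET ->
  complemented (pre f N) (pre f 1).
Proof.
move=> tiNM defT; exists (pre f M); split.
- exact: subgroup_pre.
- exact/(sub_pre qf)/sub1G.
- apply/seteqP; split=> x; rewrite /pre /=.
    by case=> Mx Nx; rewrite -tiNM inE Nx.
  by move/finset.set1P->; split; apply: group1.
apply/seteqP; split=> // x _; have : f x \in (M * N)%g by rewrite defT inE.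
case/mulsgP=> m n Mm Nn fx; have [_ _ surj] := qf; have [k fk] := surj m.
exists k; first by rewrite /pre /= fk.
exists (k^-1 * x); last by rewrite mulVKg.
by rewrite /pre /= fM (quotV qf) fk fx mulKg.
Qed.

(** Provides the hypothesis [Qcent] of [short_maximal_family], from the gamma-module condition for
    the fixed points of [H]. *)
Lemma quotient_centraliser_cap gamma N M (H : {group gT}) :
    (forall X Y : set G, chief_factor X Y -> complemented X Y ->
       exists (V : finZmodType) (A : gmodule G V),
         module_of_factor A X Y /\ gamma_module A gamma) ->
    minnormal N [set: gT]%SET -> maximal M [set: gT]%SET -> ~~ (N \subset M) ->
  exists2 s, size s <= gamma & centraliser_cap N H s.
Proof.
move=> bcf minN maxM notNM; have /mingroupp/andP[ntN nN] := minN.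
have solT := prosolvable_quotient qf solG.
have tiNM := complement_cap solT minN (finset.subsetT N) maxM notNM.
have prodMN := complement_mul minN (finset.subsetT N) maxM notNM.
have [_ _ surj] := qf.
have [V [A [[p [pD p0 pT pJ]] [_ gammaV]]]] :=
  bcf _ _ (chief_factor_pre minN) (complemented_pre tiNM prodMN).
pose W := [set v | forall g, pre f H g -> A g v = v].
have cW : centraliser A W = pre f 'C('C_N(H)) :=
  centraliser_fix qf pD p0 pT pJ nN H.
have [W' [sW' [d [b basb] le_d] capW]] := gammaV W (F_subspace_fix A (pre f H)).
have [W'b _ _] := basb.
have /choice[x_ x_P] : forall i : 'I_d, exists x, pre f N x /\ p x = b i.
  by move=> i; have [x Nx px] := factor_lift pT (b i); exists x.
have fixP g i : A g (b i) = b i <-> f g \in 'C[f (x_ i)].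
  by have [Nx <-] := x_P i; apply: (factor_act_fix qf pD p0 pJ nN).
exists (codom (fun i => f (x_ i))); first by rewrite size_codom card_ord.
split.
- by move=> _ /codomP[i ->]; have [] := x_P i.
- move=> _ /codomP[i ->]; apply/fintype.subsetP=> y Cy.
  have [g fg] := surj y; rewrite -fg; apply/fixP.
  have : centraliser A W g by rewrite cW /pre /= fg.
  by rewrite capW => -[/(_ _ (W'b i))].
move=> y sy maxy; have [g fg] := surj y; rewrite -fg.
suff : pre f 'C('C_N(H)) g by [].
rewrite -cW capW; split.
  apply: centraliser_basis basb _ => i; apply/fixP; rewrite fg.
  by apply: sy; apply: codom_f.
move=> K [maxK]; rewrite cW => sCK.
have [M' maxM' defK] := maximal_pre_surj qf maxK (subset_trans (@ker_pre _ _ f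
  'C('C_N(H))%G) sCK).
rewrite {}defK in sCK *; rewrite /pre /= fg; apply: maxy => //.
exact/(sub_pre qf).
Qed.

End Quotients.

(** Since [H] is open, it is the preimage of a subgroup [A] of a finite quotient. Maximal subgroups
    and indices correspond, so [short_maximal_family] applies there. *)
Lemma bounded_intersection_of_chief_factors (R : realType) (G :
  profiniteGroupType) :
  prosolvable G -> bounded_chief_factors_property G ->
    bounded_intersection_property R G.
Proof.
move=> solG [gamma _ bcf]; exists (gamma.+1%:R)%R; first by rewrite ltr0n.
move=> H sH oH [MM maxMM defH].
have [gT [f [qf kerf]]] := finite_quotient_exists sH oH.
have kerH : [set x | f x = 1] `<=` H.
  by move=> g /kerf/(_ 1); rewrite invg1 mul1g mulg1.
have [A defA] := pre_surj qf sH kerH.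
have [_ _ surj] := qf.
have capA : maximal_closed A.
  move=> y maxy; have [g fg] := surj y; rewrite -fg.
  suff : pre f A g by [].
  rewrite -defA defH.
  move=> K MMK; have sHK : H `<=` K by rewrite defH; apply: bigcap_inf.
  have [M maxM defK] := maximal_pre_surj qf (maxMM K MMK) (subset_trans kerH
    sHK).
  rewrite {}defK defA in sHK *; rewrite /pre /= fg; apply: maxy => //.
  exact/(sub_pre qf).
pose Q (gT : finGroupType) := exists f : G -> gT, finite_quotient f.
have [|||| s [max_s cap_s le_s]] := @short_maximal_family gamma Q _ _ _ gT A _
  capA.
- by move=> ? [? /prosolvable_quotient]; apply.
- by move=> hT N nN [h /finite_quotient_coset qh]; exists (coset N \o h);
  apply: qh.
- by move=> hT N M B [h qh] minN maxM notNM; apply: (quotient_centraliser_cap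
  solG qh B bcf minN maxM).
- by exists f.
exists (size s), (fun i => pre f (tnth (in_tuple s) i)); split.
- move=> i; apply/(maximal_pre qf).
  by have [] := max_s _ (mem_tnth i (in_tuple s)).
- rewrite defA; apply/seteqP; split=> g.
    move=> Ag i _; apply: (sub_pre qf _ _).2 Ag.
    by have [] := max_s _ (mem_tnth i (in_tuple s)).
  move=> sg; apply: cap_s => M sM; have /tnthP[i ->] : M \in in_tuple s by [].
  exact: sg.
rewrite defA index_pre // powR_mulrn // -natrX ler_nat.
rewrite (eq_bigr (fun i => #|[set: gT]%SET : tnth (in_tuple s) i|)) => [|i _];
  last exact: index_pre.
by rewrite big_tnth in le_s.
Qed.

(** * Spans and dimensions over the endomorphism field *)

Section Span.
Local Open Scope ring_scope.
Variables (G : topologicalGroupType) (V : finZmodType) (A : gmodule G V).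

Definition F_span d (b : 'I_d -> V) : set V :=
  [set w | exists2 c : 'I_d -> {additive V -> V},
     (forall i, End_G A (c i)) & w = \sum_i c i (b i)].

Lemma mem_F_span d (b : 'I_d -> V) i : F_span b (b i).
Proof.
exists (fun j => if j == i then idfun : {additive V ->
  V} else \0 : {additive V -> V}).
  by move=> j; case: (j == i) => g v //=; rewrite gact0.
rewrite (bigD1 i) //= eqxx big1 ?addr0 // => j /negPf ->.
by [].
Qed.

Lemma F_subspace_span d (b : 'I_d -> V) : F_subspace A (F_span b).
Proof.
split; first split.
- exists (fun=> \0 : {additive V -> V}); first by move=> i g v;
  rewrite /= gact0.
  by rewrite big1.
- move=> _ _ [c Fc ->] [c' Fc' ->]; exists (fun i =>
  (c i \- c' i) : {additive V -> V}).
    by move=> i g v /=; rewrite gactD gactN Fc Fc'.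
  by rewrite -sumrB; apply: eq_bigr.
move=> h Fh _ [c Fc ->]; exists (fun i => (h \o c i) : {additive V -> V}).
  by move=> i g v /=; rewrite Fc Fh.
by rewrite raddf_sum.
Qed.

Hypothesis irrA : irreducible_module A.

(** Schur's lemma: the kernel is a proper submodule, hence zero, and [V] is finite. *)
Lemma End_G_inverse (c : {additive V -> V}) v : End_G A c -> c v != 0 ->
  exists2 c' : {additive V -> V}, End_G A c' & cancel c c'.
Proof.
move=> Fc nz_cv; have [_ minV] := irrA.
have [||ker0|kerT] := minV [set u | c u = 0].
- split=> [|x y /= cx cy]; first exact: raddf0.
  by rewrite raddfB cx cy subrr.
- by move=> g u /= cu; rewrite Fc cu gact0.
- have inj_c : injective c.
    move=> x y eq_c; apply/eqP; rewrite -subr_eq0; apply/eqP.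
    have : [set u | c u = 0] (x - y) by rewrite /= raddfB eq_c subrr.
    by rewrite ker0.
  pose ci := invF inj_c.
  have ci_add : zmod_morphism ci.
    move=> x y; apply: (inj_c); rewrite raddfB.
    by rewrite !(f_invF inj_c).
  pose c' : {additive V -> V} := HB.pack ci (GRing.isZmodMorphism.Build V V ci
    ci_add).
  exists c'; last exact: invF_f.
  by move=> g u; apply: (inj_c); rewrite Fc /= !(f_invF inj_c).
case/negP: nz_cv; apply/eqP; have : [set: V] v by [].
by rewrite -kerT.
Qed.

(** Inverting the nonzero coefficient [c j] expresses [b j] through the other vectors. *)
Lemma F_span_drop d (b : 'I_d.+1 -> V) (c : 'I_d.+1 -> {additive V -> V}) j v :
    (forall i, End_G A (c i)) -> \sum_i c i (b i) = 0 -> c j v != 0 ->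
  F_span (b \o lift j) = F_span b.
Proof.
move=> Fc c0 nz_c; have [c' Fc' c'K] := End_G_inverse (Fc j) nz_c.
apply/seteqP; split=> _ [a Fa ->].
  apply: (big_ind (F_span b)) => [|x y Bx By|i _].
  - by have [[]] := F_subspace_span b.
  - have [[B0 BB] _] := F_subspace_span b.
    by rewrite -[y]opprK; apply: (BB) => //; rewrite -sub0r; apply: (BB).
  - by have [_] := F_subspace_span b; apply=> //; apply: mem_F_span.
have [[B0 BB] BF] := F_subspace_span (b \o lift j).
have BD x y : F_span (b \o lift j) x -> F_span (b \o lift j) y ->
  F_span (b \o lift j) (x + y).
  by move=> Bx By; rewrite -[y]opprK; apply: (BB) => //; rewrite -sub0r;
    apply: (BB).
have Bb i : F_span (b \o lift j) (b (lift j i))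
  by exact: (mem_F_span (b \o lift j) i).
have Bbj : F_span (b \o lift j) (b j).
  have -> : b j = - \sum_(i < d) c' (c (lift j i) (b (lift j i))).
    have cbj : c j (b j) = - \sum_(i < d) c (lift j i) (b (lift j i)).
      by apply/eqP; rewrite -addr_eq0; apply/eqP;
        rewrite -[RHS]c0 [RHS](bigD1_ord j).
    by rewrite -[LHS]c'K cbj raddfN raddf_sum.
  rewrite -sub0r; apply: (BB) => //.
  by apply: (big_ind (F_span (b \o lift j))) => // i _; apply: (BF) => //;
    apply: (BF).
apply: (big_ind (F_span (b \o lift j))) => // i _; apply: (BF) => //.
by case: (unliftP j i) => [i' ->|->].
Qed.

Lemma F_dim_span d (b : 'I_d -> V) :
  exists2 d', F_dim A (F_span b) d' & (d' <= d)%N.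
Proof.
elim: d b => [|d IHd] b.
  exists 0%N => //; exists b; split; first by case.
    by move=> w [c Fc ->]; exists c.
  by move=> c _ _ [].
have [indep | dep] := pselect (forall c : 'I_d.+1 -> {additive V -> V},
   (forall i, End_G A (c i)) -> \sum_i c i (b i) = 0 -> forall i v, c i v = 0).
  exists d.+1 => //; exists b; split=> //; first exact: mem_F_span.
have [c [Fc [c0 [j [v nz]]]]] : exists c : 'I_d.+1 -> {additive V -> V},
    (forall i, End_G A (c i)) /\ (\sum_i c i (b i) = 0 /\ exists j v,
      c j v != 0).
  apply: contrapT => nex; apply: dep => c Fc c0 j v; apply/eqP/negPn/negP => nz.
  by apply: nex; exists c; split=> //; split=> //; exists j, v.
have [d' dimd' led'] := IHd (b \o lift j).
by exists d'; [rewrite -(F_span_drop Fc c0 nz) | exact: leqW].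
Qed.

End Span.

(** A subgroup [T] above [M] is [M * (N :&: T)], where [N :&: T] is normalised by [M] and
    centralised by [N]; so it is [1] or [N]. *)
Lemma complement_maximal (gT : finGroupType) (G N M : {group gT}) :
    minnormal N G -> abelian N -> N :&: M = 1 -> (M * N)%g = G -> maximal M G.
Proof.
move=> minN cNN tiNM defG; have /mingroupp/andP[ntN nNG] := minN.
have sMG : M \subset G by rewrite -defG mulG_subl.
have sNG : N \subset G by rewrite -defG mulG_subr.
have notNM : ~~ (N \subset M) by apply: contra ntN => /finset.setIidPl <-;
  rewrite tiNM.
apply/maxgroupP; split.
  by rewrite properE sMG; apply: contra notNM; apply: fintype.subset_trans.
move=> T pTG sMT; have sTG := proper_sub pTG.
have nNT : G \subset 'N(N :&: T).
  rewrite -defG mul_subG //.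
    by rewrite normsI ?(fintype.subset_trans sMT (normG T)) //
      (fintype.subset_trans sMG).
  by rewrite cents_norm // centsC finset.subIset // [N \subset _]cNN.
have defT : T :=: M * (N :&: T) by rewrite group_modl // defG (finset.setIidPr
  sTG).
have [NT1 | sNT] := minnormal_cap minN sNG (X := (N :&: T)%G) nNT.
  by rewrite defT -{1}[gval N]finset.setIid -finset.setIA (NT1 :
    N :&: (N :&: T) = 1) mulg1.
case/negP: (proper_subn pTG); rewrite -defG mul_subG //.
exact: fintype.subset_trans sNT (finset.subsetIr _ _).
Qed.

Lemma open_quotient_preim (G : profiniteGroupType) (gT : finGroupType) (f :
  G -> gT)
    (P : set gT) :
  finite_quotient f -> open [set g | P (f g)].
Proof.
move=> [fM oker surj].
have -> : [set g | P (f g)] = \bigcup_(g in [set g | P (f g)]) [set x | f (g^-1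
  * x) = 1].
  apply/seteqP; split=> [g Pg | x [g Pg]] /=.
    by exists g => //=; rewrite mulVg; apply: (mulgI (f 1)); rewrite -fM !mulg1.
  by move=> eqf; have := fM g (g^-1 * x); rewrite mulKVg eqf mulg1 => ->.
by apply: bigcup_open => g _; apply: (open_ltranslate (H := [set x | f x = 1])).
Qed.

(** * An elementary abelian normal subgroup as a module over a prime field *)

Section AbelemModule.
Variables (G : profiniteGroupType) (gT : finGroupType) (f : G -> gT).
Hypothesis qf : finite_quotient f.
Variables (p : nat) (N : {group gT}).
Hypotheses (abelN : p.-abelem N) (ntN : N != 1 :> {set gT}).
Hypothesis nN : [set: gT]%SET \subset 'N(N).

Local Notation ErV := (abelem_rV abelN ntN).
Local Notation rV := (rVabelem abelN ntN).

Let fM : {morph f : x y / x * y}. Proof. by case: qf. Qed.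
Let NJ x y : x \in N -> x ^ y \in N.
Proof. by move=> Nx; rewrite memJ_norm // (fintype.subsetP nN) ?inE. Qed.

(** Since [y ^ z] is [z^-1 * y * z], the inverse gives the left action required by [gmodule] and
    [module_of_factor]. *)
Definition factor_act (g : G) (v : 'rV['F_p]_('dim N)) := ErV (rV v ^ (f g)^-1).

Lemma factor_act1 v : factor_act 1 v = v.
Proof. by rewrite /factor_act (quot1 qf) invg1 conjg1 rVabelemK. Qed.

Lemma factor_actM g h v : factor_act (g * h) v = factor_act g (factor_act h v).
Proof.
by rewrite /factor_act abelem_rV_K ?NJ ?mem_rVabelem // -conjgM fM invMg.
Qed.

Lemma factor_actD g u v : factor_act g (u + v)%R = (factor_act g u + factor_act
  g v)%R.
Proof.
by rewrite /factor_act rVabelemD conjMg abelem_rV_M ?NJ ?mem_rVabelem.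
Qed.

Lemma factor_act_continuous u v : open [set g | factor_act g u = v].
Proof. exact: (open_quotient_preim (fun y => ErV (rV u ^ y^-1) = v) qf). Qed.

Definition factor_gmodule :=
  GModule factor_act1 factor_actM factor_actD factor_act_continuous.

Let P x := ErV (f x).

Lemma factor_projD x y : pre f N x -> pre f N y -> P (x * y) = (P x + P y)%R.
Proof. by rewrite /pre /P /= => Nx Ny; rewrite fM abelem_rV_M. Qed.

Lemma factor_proj0 x : pre f N x -> (P x = 0%R <-> pre f 1 x).
Proof.
rewrite /pre /P /= => Nx; split=> [Px0 | /finset.set1P ->];
  last exact: abelem_rV_1.
by apply/finset.set1P; apply: (abelem_rV_inj (abelE := abelN) (ntE := ntN)) =>
  //; rewrite Px0 abelem_rV_1.
Qed.

Lemma factor_projT : P @` pre f N = [set: 'rV['F_p]_('dim N)].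
Proof.
have [_ _ surj] := qf; apply/seteqP; split=> // v _.
have [x fx] := surj (rV v); exists x; rewrite ?/pre ?/P /= fx ?rVabelemK //.
exact: mem_rVabelem.
Qed.

Lemma factor_projJ g x : pre f N x -> P (g * x * g^-1) = factor_gmodule g (P x).
Proof.
rewrite /pre /P /= => Nx; rewrite /factor_act abelem_rV_K // !fM (quotV qf).
by rewrite conjgE invgK mulgA.
Qed.

(** A submodule corresponds to a subgroup [B] of [N] normal in the whole group, so minimality of [N]
    decides. *)
Lemma factor_irreducible : minnormal N [set: gT]%SET ->
  irreducible_module factor_gmodule.
Proof.
move=> minN; split.
  have [y Ny nty] : exists2 y, y \in N & y != 1 by apply/trivgPn.
  exists (ErV y); apply: contra nty => /eqP Ey0; apply/eqP.
  by apply: (abelem_rV_inj (abelE := abelN) (ntE := ntN)) => //;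
    rewrite Ey0 abelem_rV_1.
move=> W [W0 WB] WG; have [_ _ surj] := qf.
have WN u : W u -> W (- u)%R by move=> Wu; rewrite -sub0r; apply: WB.
pose B := [set y in N | `[< W (ErV y) >]]%SET.
have gB : group_set B.
  apply/group_setP; split=> [|y z].
    by rewrite inE group1; apply/asboolP; rewrite abelem_rV_1.
  rewrite ![_ \in B]inE => /andP[Ny /asboolP Wy] /andP[Nz /asboolP Wz].
  rewrite groupM //; apply/asboolP; rewrite abelem_rV_M // -[ErV z]opprK.
  by apply: (WB) => //; apply: WN.
have nB : [set: gT]%SET \subset 'N(B).
  apply/fintype.subsetP=> y _; rewrite inE; apply/fintype.subsetP=> _ /imsetP[z
    + ->].
  rewrite ![_ \in B]inE => /andP[Nz /asboolP Wz]; rewrite NJ //; apply/asboolP.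
  have [g fg] := surj y^-1; have := WG g _ Wz.
  by rewrite /= /factor_act fg invgK abelem_rV_K.
have [B1 | ntB] := eqVneq B 1.
  left; apply/seteqP; split=> [v Wv | v ->] //=.
  have : rV v \in B by rewrite inE mem_rVabelem; apply/asboolP;
    rewrite rVabelemK.
  by rewrite B1 => /finset.set1P rv1; rewrite -[v](rVabelemK abelN ntN) rv1
    abelem_rV_1.
right; apply/seteqP; split=> // v _.
have [_ minN'] := mingroupP minN.
have eqB : B = N.
  apply: (minN' (Group gB)); first by rewrite /= ntB.
  by apply/fintype.subsetP=> y; rewrite inE => /andP[].
have : rV v \in B by rewrite eqB mem_rVabelem.
by rewrite inE mem_rVabelem => /asboolP; rewrite rVabelemK.
Qed.

End AbelemModule.

(** In the finite quotient by [Y], the bounded intersection property is applied to the centraliser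
    of [W] in a complement [M]. [complement_family] turns the resulting maximal subgroups into the
    vectors that span W^*. *)
Lemma chief_factors_of_bounded_intersection (R : realType) (G :
  profiniteGroupType) :
  prosolvable G -> bounded_intersection_property R G ->
    bounded_chief_factors_property G.
Proof.
move=> solG [eta eta_gt0 bip].
(* The [7] is the exponent in [complement_centraliser_index]. *)
pose gamma := Num.bound (7%:R * eta)%R.
have eta7 : (7%:R * eta < gamma%:R :> R)%R.
  by apply: archi_boundP; rewrite mulr_ge0 // ltW.
have gamma_gt0 : 0 < gamma.
  by rewrite -(ltr0n R); apply: le_lt_trans eta7; rewrite mulr_ge0 // ltW.
exists gamma => // X Y [[nX oX nY oY [sYX nsXY]] chiefXY] [K [sK sYK KX_Y
  KX_T]].
(* The kernel of this quotient is the core of [Y], which is [Y] itself by normality. *)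
have [gT [f [qf kerf]]] := finite_quotient_exists nY.1 oY.
have kerY : [set x | f x = 1] = Y.
  apply/seteqP; split=> g /=; first by move/kerf/(_ 1);
    rewrite invg1 mul1g mulg1.
  by move=> Yg; apply/kerf => x; have := nY.2 g x Yg; rewrite conjgE mulgA.
have [_ _ surj] := qf; have fM : {morph f : x y / x * y} by case: qf.
have defY : Y = pre f 1.
  rewrite -kerY; apply/seteqP; split=> g; rewrite /pre /= ?inE;
    first by move=> ->.
  by move/eqP.
have [N defX] : exists N : {group gT}, X = pre f N.
  by apply: (pre_surj qf nX.1); rewrite kerY.
have [M defK] : exists M : {group gT}, K = pre f M by apply: (pre_surj qf sK);
  rewrite kerY.
have nN : [set: gT]%SET \subset 'N(N).
  apply/fintype.subsetP=> y _; rewrite inE; apply/fintype.subsetP=> _ /imsetP[z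
    + ->].
  have [g <-] := surj z; have [h <-] := surj y => Ng.
  have := nX.2 g h; rewrite defX /pre /= conjgE !fM (quotV qf) -conjgE; exact.
have ntN : N :!=: 1.
  by apply: contra_notN nsXY => /eqP N1; rewrite defX defY N1.
have minN : minnormal N [set: gT]%SET.
  apply/mingroupP; split; first by rewrite ntN.
  move=> B /andP[ntB nB] sBN.
  have [||| eqB | eqB] := chiefXY (pre f B).
  - exact: normal_pre.
  - by rewrite defY; apply/(sub_pre qf)/sub1G.
  - by rewrite defX; apply/(sub_pre qf).
  - by case/eqP: ntB; apply: (pre_inj qf); rewrite eqB.
  - by apply: (pre_inj qf); rewrite eqB.
have solT := prosolvable_quotient qf solG.
have [_ _ /is_abelemP[p p_pr abelN]] := minnormal_solvable minN (finset.subsetT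
  N) solT.
have cNN := abelem_abelian abelN.
have tiNM : N :&: M = 1.
  apply: (pre_inj qf); rewrite -defY -KX_Y defK defX.
  apply/seteqP; split=> g; rewrite /pre /= inE; first by case/andP.
  by case=> -> ->.
have prodMN : (M * N)%g = [set: gT]%SET.
  apply/finset.setP=> y; rewrite inE; apply/mulsgP; have [g <-] := surj y.
  have : [set k * x | k in K & x in X] g by rewrite KX_T.
  by case=> k Kk [x Xx <-]; rewrite defK defX in Kk Xx; exists (f k) (f x).
have maxM := complement_maximal minN cNN tiNM prodMN.
have notNM : ~~ (N \subset M) by apply: contra ntN => /finset.setIidPl <-;
  rewrite tiNM.
pose A := factor_gmodule qf abelN ntN nN; pose P x := abelem_rV abelN ntN (f x).
have irrA : irreducible_module A := factor_irreducible qf abelN ntN nN minN.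
have pD := factor_projD qf abelN ntN; have p0 :=
  @factor_proj0 G _ f _ _ abelN ntN.
have pT := factor_projT qf abelN ntN; have pJ := factor_projJ qf abelN ntN nN.
have fixP g x : pre f N x -> A g (P x) = P x <-> f g \in 'C[f x].
  exact: (@factor_act_fix _ _ _ qf N _ A P pD p0 pJ nN).
exists 'rV['F_p]_('dim N), A; split; first by exists P; rewrite defX defY.
split=> // W sW.
pose WN := [set y in N | `[< W (abelem_rV abelN ntN y) >]]%SET.
have sWN : WN \subset N by apply/fintype.subsetP=> y; rewrite inE => /andP[].
have cW : centraliser A W = pre f 'C(WN).
  apply/seteqP; split=> g cg.
    rewrite /pre /=; apply/centP=> y; rewrite inE => /andP[Ny /asboolP Wy].
    have [x fx] := surj y; rewrite -fx in Ny Wy *.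
    by apply/cent1P/fixP => //; apply: cg.
  move=> w Ww; have [x Nx px] := factor_lift pT w; rewrite -px in Ww *.
  apply/fixP => //; apply/cent1P; apply: (centP cg).
  by rewrite inE; apply/andP; split=> //; apply/asboolP.
pose H := 'C_M(WN)%G.
have capH : maximal_closed H := complement_centraliser_closed solT minN maxM
  notNM sWN.
have [|t [Mi [maxMi defH le_idx]]] := bip (pre f H) (subgroup_pre qf H)
  (open_pre qf H).
  exists [set L | exists2 B : {group gT}, maximal B [set: gT]%SET /\ H \subset
    B & L = pre f B].
    by move=> _ [B [maxB _] ->]; apply/(maximal_pre qf).
  apply/seteqP; split=> [g Hg _ [B [_ sHB] ->] | g Hg];
    first exact: (sub_pre qf H B).2 sHB g Hg.
  by apply: capH => B maxB sHB; apply: (Hg (pre f B)); exists B.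
have /choice[m mP] : forall i : 'I_t, exists B : {group gT},
  maximal B [set: gT]%SET /\ Mi i = pre f B.
  move=> i; have kerM : [set x | f x = 1] `<=` Mi i.
    move=> g /= fg; have : pre f H g by rewrite /pre /= fg group1.
    by rewrite defH; apply.
  by have [B maxB defB] := maximal_pre_surj qf (maxMi i) kerM; exists B.
pose s := codom m.
have sHm i : H \subset m i.
  by apply/(sub_pre qf); rewrite -(mP i).2 defH; apply: bigcap_inf.
have [||vs [vsN le_vs vsC capvs]] := complement_family solT minN maxM notNM sWN
  (s := s).
- by move=> _ /codomP[i ->]; split; [have [] := mP i | exact: sHm].
- move=> y sy; have [g fg] := surj y; rewrite -fg; suff : pre f H g by [].
  by rewrite defH => i _; rewrite (mP i).2 /pre /= fg; apply: sy;
    apply: codom_f.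
have N_gt1 : 1 < #|N| by rewrite cardG_gt1.
(* Compares powers of [#|N|]: [#|N| ^ size vs] is at most the product of the indices, hence at most
   the index of [H] to the power [eta], hence at most [#|N|] to the power [7 * eta]. *)
have size_vs : size vs <= gamma.
  rewrite -(leq_exp2l _ _ N_gt1) -(ler_nat R).
  apply: (@le_trans _ _ ((\prod_(i < t) subgroup_index (Mi i))%N%:R)%R).
    rewrite ler_nat (leq_trans le_vs) // /s codomE big_map big_enum /=.
    by apply: leq_prod => i _; rewrite (mP i).2 index_pre.
  apply: le_trans le_idx _; rewrite index_pre //.
  have le7 := complement_centraliser_index solT minN maxM notNM sWN.
  apply: (@le_trans _ _ (((#|N| ^ 7)%N%:R : R) `^ eta)%R).
    by apply: ge0_ler_powR; rewrite ?nnegrE ?ler0n ?ler_nat // ltW.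
  rewrite natrX -powR_mulrn ?ler0n // -powRrM [X in (_ <= X)%R]natrX
    -powR_mulrn ?ler0n //.
  by apply: ler_powR; [rewrite ler1n cardG_gt0 | exact: ltW].
have [x_ x_P] : exists x_ : 'I_(size vs) -> G, forall i,
  f (x_ i) = tnth (in_tuple vs) i.
  by have /choice[h hP] := fun i : 'I_(size vs) =>
    surj (tnth (in_tuple vs) i); exists h.
have Nx i : pre f N (x_ i) by rewrite /pre /= x_P vsN // mem_tnth.
pose b i := P (x_ i).
(* The vectors of [b] may be dependent over the endomorphism field; their span then has smaller
   dimension, which is harmless. *)
have [d dim_d le_d] := F_dim_span irrA b.
exists (F_span A b); split; first exact: F_subspace_span.
  by exists d => //; apply: leq_trans size_vs.
apply/seteqP; split=> g cg.
  split; last by move=> L [_]; apply.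
  have gb i : A g (b i) = b i.
    apply/fixP => //; rewrite x_P; apply: (fintype.subsetP (vsC _ (mem_tnth i
      (in_tuple vs)))).
    by rewrite cW in cg.
  by move=> _ [c Fc ->]; rewrite gact_sum; apply: eq_bigr => i _;
    rewrite -Fc gb.
case: cg => cb maxg; rewrite cW; apply: capvs => [v vsv | B maxB sCB].
  have /tnthP[i ->] : v \in in_tuple vs by [].
  by rewrite -x_P; apply/fixP => //; apply: cb; apply: mem_F_span.
suff : pre f B g by [].
apply: maxg; split; first exact/(maximal_pre qf).
by rewrite cW; apply/(sub_pre qf).
Qed.

Theorem theorem10 (R : realType) (G : profiniteGroupType) (hG : prosolvable G) :
  bounded_intersection_property R G <-> bounded_chief_factors_property G.
Proof.
split; first exact: chief_factors_of_bounded_intersection.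
exact: bounded_intersection_of_chief_factors.
Qed.
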